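(* Every nonzero $2$-dimensional complex symmetric Leibniz algebra is isomorphic to a critical point of $F_2$, that is, for every $[\mu]\in S_2$ the orbit $\mathrm{GL}(2).[\mu]$ contains a critical point of $F_2:S_2\to\mathbb{R}$. On the other hand, there exist $3$-dimensional complex symmetric Leibniz algebras which are not isomorphic to any critical point of $F_3$, that is, there exists $[\mu]\in S_3$ such that $\mathrm{GL}(3).[\mu]$ contains no critical point of $F_3:S_3\to\mathbb{R}$.
   Context: Let $V_n=\otimes^2(\mathbb{C}^n)^*\otimes\mathbb{C}^n$ be the space of all bilinear maps $\mu:\mathbb{C}^n\times\mathbb{C}^n\to\mathbb{C}^n$. $\mathrm{GL}(n)$ acts on $V_n$ by $g.\mu(X,Y)=g\mu(g^{-1}X,g^{-1}Y)$, so $\mathrm{GL}(n).\mu$ is the isomorphism class of $\mu$; the action descends to $\mathbb{P}V_n$. Fix a Hermitian inner product on $\mathbb{C}^n$; it induces the Hermitian inner product $\langle\mu,\lambda\rangle=\sum_{i,j,k}\langle\mu(X_i,X_j),X_k\rangle\overline{\langle\lambda(X_i,X_j),X_k\rangle}$ on $V_n$, where $\{X_i\}$ is any orthonormal basis of $\mathbb{C}^n$. On $\mathfrak{gl}(n)$ put $(A,B)=\operatorname{tr}AB^*$, where $^*$ is the conjugate transpose with respect to the fixed inner product; $\mathrm{i}\mathfrak{u}(n)$ is the space of Hermitian operators. The moment map $m:\mathbb{P}V_n\to\mathrm{i}\mathfrak{u}(n)$ is defined by $(m([\mu]),A)=(\mathrm{d}\rho_\mu)_eA/\|\mu\|^2$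 for $A\in\mathrm{i}\mathfrak{u}(n)$, where $\rho_\mu(g)=\langle g.\mu,g.\mu\rangle$, and $F_n([\mu])=\|m([\mu])\|^2=(m([\mu]),m([\mu]))$. A symmetric Leibniz algebra is an algebra satisfying $x(yz)=(xy)z+y(xz)$ and $(xy)z=(xz)y+x(yz)$ for all $x,y,z$. $S_n\subset\mathbb{P}V_n$ is the projectivization of the algebraic variety of all symmetric Leibniz algebra structures on $\mathbb{C}^n$. The critical points of $F_n:S_n\to\mathbb{R}$ are precisely the critical points of $F_n:\mathbb{P}V_n\to\mathbb{R}$ that lie in $S_n$. *)

(* Defs.v *)
From mathcomp Require Import all_boot all_order all_algebra.
From mathcomp Require Import complex.
From mathcomp Require Import all_classical all_reals all_analysis.

Set Implicit Arguments.
Unset Strict Implicit.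
Unset Printing Implicit Defensive.

Import Order.TTheory GRing.Theory Num.Theory.
Import numFieldNormedType.Exports.

Local Open Scope classical_set_scope.
Local Open Scope ring_scope.
Local Open Scope complex_scope.

(* An element of V_n is recorded by the vectors mu(e_i, e_j), where (e_i) is
   the canonical basis of C^n; these values are arbitrary, and [bil mu] is the
   bilinear map they determine. *)
Definition algV (R : realType) (n : nat) := {ffun 'I_n * 'I_n -> 'cV[R[i]]_n}.

Section SymmetricLeibniz.
Variables (R : realType) (n : nat).
Implicit Types (mu lambda : algV R n) (g A B M : 'M[R[i]]_n).

Definition bil mu (x y : 'cV[R[i]]_n) : 'cV[R[i]]_n :=
  \sum_i \sum_j (x i 0 * y j 0) *: mu (i, j).

Definition act g mu : algV R n :=
  [ffun p : 'I_n * 'I_n => g *m bil mu (invmx g *m delta_mx p.1 0)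
                                       (invmx g *m delta_mx p.2 0)].

Lemma bil_act g mu x y :
  bil (act g mu) x y = g *m bil mu (invmx g *m x) (invmx g *m y).
Proof.
rewrite /bil; transitivity (\sum_i \sum_j (x i 0 * y j 0) *:
    (g *m bil mu (invmx g *m delta_mx i 0) (invmx g *m delta_mx j 0))).
  by apply: eq_bigr => i _; apply: eq_bigr => j _; rewrite ffunE.
under eq_bigr do under eq_bigr do rewrite scalemxAr.
under eq_bigr do rewrite -mulmx_sumr.
rewrite -mulmx_sumr; congr (_ *m _); rewrite /bil.
under eq_bigr do under eq_bigr do rewrite scaler_sumr.
under eq_bigr do rewrite exchange_big /=.
rewrite exchange_big; apply: eq_bigr => k _ /=.
under eq_bigr do under eq_bigr do rewrite scaler_sumr.
under eq_bigr do rewrite exchange_big /=.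
rewrite exchange_big; apply: eq_bigr => l _ /=.
under eq_bigr do under eq_bigr do rewrite scalerA.
under eq_bigr do rewrite -scaler_suml.
rewrite -scaler_suml; congr (_ *: _).
rewrite [(_ *m x) k 0]mxE [(_ *m y) l 0]mxE big_distrl /=.
apply: eq_bigr => i _; rewrite big_distrr /=; apply: eq_bigr => j _.
by rewrite -!colE !mxE mulrC [LHS]mulrACA.
Qed.

Definition symmetric_Leibniz mu := forall x y z,
  bil mu x (bil mu y z) = bil mu (bil mu x y) z + bil mu y (bil mu x z) /\
  bil mu (bil mu x y) z = bil mu (bil mu x z) y + bil mu x (bil mu y z).

(* Points of the projective space are given by nonzero representatives. *)
Definition in_S mu := mu != 0 /\ symmetric_Leibniz mu.

(* [h] is the fixed Hermitian inner product (linear in the first variable) and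
   [X] an orthonormal basis for it. *)
Variables (h : {dot 'cV[R[i]]_n for Num.conj}) (X : n.-tuple 'cV[R[i]]_n).

Definition innerV mu lambda : R[i] :=
  \sum_i \sum_j \sum_k
    h (bil mu (tnth X i) (tnth X j)) (tnth X k) *
    (h (bil lambda (tnth X i) (tnth X j)) (tnth X k))^*.

Definition normsqV mu : R := complex.Re (innerV mu mu).

Definition adjoint_op A : 'M[R[i]]_n :=
  xget 0 [set B : 'M[R[i]]_n | forall x y, h (A *m x) y = h x (B *m y)].

Definition hermitian_op A := forall x y, h (A *m x) y = h x (A *m y).

Definition innerM A B : R[i] := \tr (A *m adjoint_op B).

Definition rho mu g : R := normsqV (act g mu).

(* Since GL(n) is open in gl(n), the differential of [rho mu] at the identity
   in the direction A is the derivative at t = 0 along t |-> 1 + t A. *)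
Definition drho mu A : R :=
  derive1 (fun t : R => rho mu (1%:M + t%:C *: A)) 0.

(* Riesz representation: the two conditions determine the moment map uniquely. *)
Definition moment mu : 'M[R[i]]_n :=
  xget 0 [set M : 'M[R[i]]_n | hermitian_op M /\
    forall A, hermitian_op A -> innerM M A = (drho mu A / normsqV mu)%:C].

Definition Fn mu : R := complex.Re (innerM (moment mu) (moment mu)).

(* [Fn] is invariant under rescaling of mu, and V_n \ {0} -> PV_n is a
   submersion: the differential of F_n : PV_n -> R vanishes at [mu] iff all the
   (real) directional derivatives of the smooth function [Fn] vanish at mu. *)
Definition critical_PV mu :=
  mu != 0 /\
  forall v : algV R n, is_derive (0 : R) (1 : R) (fun t : R => Fn (mu + t%:C *: v)) 0.

(* S_n may be singular; critical points of F_n on S_n are the critical points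
   of F_n on PV_n that lie in S_n. *)
Definition critical_S mu := in_S mu /\ critical_PV mu.

End SymmetricLeibniz.

(* Main.v *)
(* Any orthonormal basis X turns mu into structure constants nu, with respect to
   which m([mu]) is N(nu) / |nu|^2, where N(nu) is the Hermitian matrix with
   tr (N(nu) A) = 2 <A.nu, nu>.  Differentiating F(nu) = tr N(nu)^2 / |nu|^4 gives
     dF(w) = 8 Re (<N(nu).nu, w> |nu|^2 - <N(nu).nu, nu> <nu, w>) / |nu|^6,
   so nu is critical as soon as N(nu).nu is a real multiple of nu.

   In a symmetric Leibniz algebra squares annihilate everything, so that a nonzero
   one of dimension 2 has a basis with e0 e0 = e1 or e0 e1 = - e1 e0 = e1 (and all
   other products zero).  Placed on an orthonormal basis, both satisfy the
   eigenvalue condition.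

   In dimension 3 consider e2 e2 = e2 e1 = - e1 e2 = e0.  By the QR decomposition
   every algebra in its orbit has, in a suitable orthonormal basis, the same shape
   with coefficients s, a, - a where s and a are nonzero.  Its symmetric part s
   degenerates to 0 under a one-parameter group that fixes the skew part, and
   indeed dF does not vanish in the direction of the symmetric part. *)
From HB Require Import structures.
Require Import Defs.
From mathcomp Require Import all_boot all_order all_algebra.
From mathcomp Require Import complex.
From mathcomp Require Import all_classical all_reals all_analysis.
From mathcomp Require Import ring.

Set Implicit Arguments.
Unset Strict Implicit.
Unset Printing Implicit Defensive.

Import Order.TTheory GRing.Theory Num.Theory.
Import numFieldNormedType.Exports.

Local Open Scope complex_scope.
Local Open Scope classical_set_scope.
Local Open Scope ring_scope.
Local Open Scope sesquilinear_scope.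

Local Notation e_ i := (delta_mx i 0).

(** * The standard Hermitian product on column vectors *)

Section DotC.
Variables (C : numClosedFieldType) (n : nat).
Implicit Types (u v w : 'cV[C]_n) (A F G : 'M[C]_n).

Definition dotc u v : C := \sum_k u k 0 * (v k 0)^*.

Lemma dotcDl u v w : dotc (u + v) w = dotc u w + dotc v w.
Proof. by rewrite -big_split; apply: eq_bigr => k _; rewrite mxE mulrDl. Qed.

Lemma dotcZl a u w : dotc (a *: u) w = a * dotc u w.
Proof. by rewrite mulr_sumr; apply: eq_bigr => k _; rewrite mxE mulrA. Qed.

Lemma dotcBl u v w : dotc (u - v) w = dotc u w - dotc v w.
Proof. by rewrite -scaleN1r dotcDl dotcZl mulN1r. Qed.

Lemma dotcC u v : dotc u v = (dotc v u)^*.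
Proof.
by rewrite rmorph_sum; apply: eq_bigr => k _; rewrite rmorphM /= conjCK mulrC.
Qed.

Lemma dotc_e u k : dotc u (e_ k) = u k 0.
Proof.
rewrite /dotc (bigD1 k) //= mxE !eqxx rmorph1 mulr1 big1 ?addr0 // => i ik.
by rewrite mxE (negbTE ik) rmorph0 mulr0.
Qed.

Lemma dotc_adj A u v : dotc (A *m u) v = dotc u (A^t* *m v).
Proof.
rewrite /dotc; under eq_bigr do rewrite mxE mulr_suml.
rewrite exchange_big /=; apply: eq_bigr => i _.
rewrite mxE rmorph_sum mulr_sumr; apply: eq_bigr => j _.
by rewrite !mxE rmorphM /= conjCK mulrCA mulrA.
Qed.


(** With ' for the adjoint, the two sides are tr (G' F A) and tr (A G' F), equal by cyclicity. This
    moves an operator acting on one argument of a product to the other side of the inner product. *)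
Lemma sum_dotc_adj F G A :
  \sum_i dotc (F *m (A *m e_ i)) (G *m e_ i) =
  \sum_i dotc (F *m e_ i) (G *m (A^t* *m e_ i)).
Proof.
have trE (M N : 'M[C]_n) : \sum_i dotc (M *m e_ i) (N *m e_ i) = \tr (N^t* *m M).
  apply: eq_bigr => i _.
  have -> : N *m e_ i = (N^t*)^t* *m e_ i by rewrite trmxCK.
  by rewrite -dotc_adj dotc_e mulmxA -colE mxE.
under eq_bigr do rewrite mulmxA; under [RHS]eq_bigr do rewrite mulmxA.
by rewrite !trE trmx_mul map_mxM trmxCK mulmxA mxtrace_mulC mulmxA.
Qed.

Lemma dotc_inj v w : (forall u, dotc u v = dotc u w) -> v = w.
Proof.
move=> vw; apply/colP => k; have := vw (e_ k); rewrite dotcC [RHS]dotcC !dotc_e.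
exact: (inv_inj conjCK).
Qed.

Lemma mulmx_cV_inj A F : (forall v, A *m v = F *m v) -> A = F.
Proof.
move=> AF; apply/matrixP => i j; have /colP/(_ i) := AF (e_ j).
by rewrite -!colE ![col _ _ _ _]mxE.
Qed.

Lemma dotc_adj_unique A F :
  (forall u v, dotc (A *m u) v = dotc u (F *m v)) -> F = A^t*.
Proof.
move=> AF; apply: mulmx_cV_inj => v; apply: dotc_inj => u.
by rewrite -AF dotc_adj.
Qed.

Lemma dotc_unitary A :
  (forall u v, dotc (A *m u) (A *m v) = dotc u v) -> A \is unitarymx.
Proof.
(* [unitarymx] asks for A A' = 1, whereas preserving the product gives A' A = 1; hence the passage
   to the adjoint. *)
move=> AA; rewrite -trmxC_unitary; apply/unitarymxP; rewrite trmxCK.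
apply: mulmx_cV_inj => v; apply: dotc_inj => u.
by rewrite mul1mx -[RHS]AA dotc_adj mulmxA.
Qed.

End DotC.

(** * Bilinear products and the GL(n) action *)

Lemma invmxM (F : fieldType) n (A B : 'M[F]_n) :
  A \in unitmx -> B \in unitmx -> invmx (A *m B) = invmx B *m invmx A.
Proof.
move=> uA uB; have uAB : A *m B \in unitmx by rewrite unitmx_mul uA.
apply: (can_inj (mulKmx uAB)); rewrite mulmxV // mulmxA -[A *m B *m _]mulmxA.
by rewrite mulmxV // mulmx1 mulmxV.
Qed.

Lemma unitmx_cV_inj (F : fieldType) n (A : 'M[F]_n) :
  (forall v : 'cV_n, A *m v = 0 -> v = 0) -> A \in unitmx.
Proof.
move=> A0; rewrite -unitmx_tr -row_free_unit -kermx_eq0.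
apply/eqP/row_matrixP => i; rewrite row0; apply: trmx_inj; rewrite trmx0.
apply: A0; apply: trmx_inj; rewrite trmx_mul trmxK trmx0.
by apply/sub_kermxP; exact: row_sub.
Qed.

Section Algebras.
Variables (R : realType) (n : nat).
Local Notation C := R[i].
Implicit Types (x y z : algV R n) (u v w : 'cV[C]_n) (A g k : 'M[C]_n).

Lemma cV_sum_delta u : u = \sum_i u i 0 *: e_ i.
Proof. by rewrite [LHS]matrix_sum_delta; apply: eq_bigr => i _; rewrite big_ord1. Qed.

Lemma bil_linearl x v : linear (bil x ^~ v).
Proof.
move=> a u w; rewrite /bil scaler_sumr -big_split; apply: eq_bigr => i _ /=.
rewrite scaler_sumr -big_split; apply: eq_bigr => j _ /=.
by rewrite !mxE mulrDl scalerDl -mulrA scalerA.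
Qed.

Lemma bil_linearr x u : linear (bil x u).
Proof.
move=> a v w; rewrite /bil scaler_sumr -big_split; apply: eq_bigr => i _ /=.
rewrite scaler_sumr -big_split; apply: eq_bigr => j _ /=.
by rewrite !mxE mulrDr scalerDl mulrCA scalerA.
Qed.

HB.instance Definition _ x := bilinear_isBilinear.Build C
  'cV[C]_n 'cV[C]_n 'cV[C]_n *:%R *:%R (bil x) (bil_linearl x, bil_linearr x).

Lemma bilDl x u w v : bil x (u + w) v = bil x u v + bil x w v.
Proof. by have := bil_linearl x v 1 u w; rewrite /= !scale1r. Qed.

Lemma bilDr x u v w : bil x u (v + w) = bil x u v + bil x u w.
Proof. by have := bil_linearr x u 1 v w; rewrite !scale1r. Qed.

Lemma bilZl x a u v : bil x (a *: u) v = a *: bil x u v.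
Proof. exact: linearZl_LR. Qed.

Lemma bilZr x a u v : bil x u (a *: v) = a *: bil x u v.
Proof. exact: linearZr_LR. Qed.

Lemma bil_unique x (B : 'cV[C]_n -> 'cV[C]_n -> 'cV[C]_n) :
  (forall v, linear (B ^~ v)) -> (forall u, linear (B u)) ->
  (forall i j, x (i, j) = B (e_ i) (e_ j)) -> forall u v, bil x u v = B u v.
Proof.
move=> Bl Br xB u v.
(* Packing the partial applications as linear maps lets each argument be expanded in the canonical
   basis. *)
pose L w : {linear 'cV[C]_n -> 'cV[C]_n} :=
  HB.pack (B ^~ w) (GRing.isLinear.Build C _ _ _ _ (Bl w)).
pose M w : {linear 'cV[C]_n -> 'cV[C]_n} :=
  HB.pack (B w) (GRing.isLinear.Build C _ _ _ _ (Br w)).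
rewrite -[B u v]/(L v u) [in RHS](cV_sum_delta u) linear_sum.
apply: eq_bigr => i _; rewrite linearZ /= -[B _ v]/(M (e_ i) v).
rewrite [in RHS](cV_sum_delta v) linear_sum scaler_sumr.
by apply: eq_bigr => j _; rewrite linearZ /= scalerA -xB.
Qed.

Lemma bil_delta x i j : bil x (e_ i) (e_ j) = x (i, j).
Proof.
rewrite /bil (bigD1 i) //= [X in _ + X]big1 ?addr0 => [|k ki]; last first.
  by apply: big1 => l _; rewrite mxE (negbTE ki) mul0r scale0r.
rewrite (bigD1 j) //= big1 => [|k kj]; rewrite !mxE ?eqxx ?mul1r ?scale1r ?addr0 //.
by rewrite (negbTE kj) scale0r.
Qed.

Lemma algV_eq x y : (forall u v, bil x u v = bil y u v) -> x = y.
Proof. by move=> xy; apply/ffunP => -[i j]; rewrite -!bil_delta xy. Qed.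

Lemma bil_add x y u v : bil (x + y) u v = bil x u v + bil y u v.
Proof.
rewrite /bil -big_split; apply: eq_bigr => i _ /=; rewrite -big_split.
by apply: eq_bigr => j _; rewrite ffunE scalerDr.
Qed.

Lemma bil_scale a x u v : bil (a *: x) u v = a *: bil x u v.
Proof.
rewrite /bil scaler_sumr; apply: eq_bigr => i _ /=; rewrite scaler_sumr.
by apply: eq_bigr => j _; rewrite ffunE !scalerA mulrC.
Qed.

Lemma actM g k x : g \in unitmx -> k \in unitmx ->
  act g (act k x) = act (g *m k) x.
Proof.
move=> ug uk; apply: algV_eq => u v; rewrite [in LHS]bil_act [in LHS]bil_act.
by rewrite [in RHS]bil_act (invmxM ug uk) !mulmxA.
Qed.

Lemma act1 x : act 1%:M x = x.
Proof. by apply: algV_eq => u v; rewrite bil_act invmx1 !mul1mx. Qed.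

Lemma actK g x : g \in unitmx -> act (invmx g) (act g x) = x.
Proof. by move=> ug; rewrite actM ?unitmx_inv // mulVmx // act1. Qed.

Lemma actVK g x : g \in unitmx -> act g (act (invmx g) x) = x.
Proof. by move=> ug; rewrite actM ?unitmx_inv // mulmxV // act1. Qed.

Lemma act_linear g : linear (@act R n g).
Proof.
move=> a x y; apply: algV_eq => u v.
by rewrite bil_add bil_scale !bil_act bil_add bil_scale mulmxDr -scalemxAr.
Qed.

HB.instance Definition _ g :=
  GRing.isLinear.Build C (algV R n) (algV R n) _ (@act R n g) (@act_linear g).

Lemma act0 g : act g (0 : algV R n) = 0.
Proof. exact: linear0. Qed.

Lemma actDZ g x a y : act g (x + a *: y) = act g x + a *: act g y.
Proof. by rewrite addrC act_linear addrC. Qed.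

(** The action of the Lie algebra gl(n) on V_n: the differential at the identity of g |-> g.x. *)
Definition inf_act A x : algV R n :=
  [ffun p => A *m x p - bil x (A *m e_ p.1) (e_ p.2)
                      - bil x (e_ p.1) (A *m e_ p.2)].

Lemma bil_inf_act A x u v :
  bil (inf_act A x) u v = A *m bil x u v - bil x (A *m u) v - bil x u (A *m v).
Proof.
pose B u v := A *m bil x u v - bil x (A *m u) v - bil x u (A *m v).
rewrite -[RHS]/(B u v); apply: bil_unique => [{}v a {}u w|{}u a {}v w|i j].
all: rewrite /B /=.
- rewrite !(mulmxDr, bilDl, bilZl, scalerBr, opprD, =^~ scalemxAr) /=.
  by rewrite [RHS]addrACA; congr (_ + _); rewrite [RHS]addrACA.
- rewrite !(mulmxDr, bilDr, bilZr, scalerBr, opprD, =^~ scalemxAr) /=.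
  by rewrite [RHS]addrACA; congr (_ + _); rewrite [RHS]addrACA.
- by rewrite ffunE bil_delta.
Qed.
End Algebras.

(** * The invariant inner product on V_n *)

Section InnerProduct.
Variables (R : realType) (n : nat).
Local Notation C := R[i].
Implicit Types (x y z : algV R n) (u v w : 'cV[C]_n) (A B U g k : 'M[C]_n).

Lemma inf_actDl A B x : inf_act (A + B) x = inf_act A x + inf_act B x.
Proof.
apply: algV_eq => u v; rewrite bil_add [in LHS]bil_inf_act.
rewrite [X in _ = X + _]bil_inf_act [X in _ = _ + X]bil_inf_act.
rewrite !mulmxDl bilDl bilDr.
by rewrite !opprD [RHS]addrACA; congr (_ + _); rewrite [RHS]addrACA.
Qed.

Lemma inf_actZl a A x : inf_act (a *: A) x = a *: inf_act A x.
Proof.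
apply: algV_eq => u v; rewrite bil_scale [in LHS]bil_inf_act.
rewrite [in RHS]bil_inf_act -!scalemxAl.
by rewrite bilZl bilZr !scalerBr.
Qed.

Lemma inf_actD A x y : inf_act A (x + y) = inf_act A x + inf_act A y.
Proof.
apply: algV_eq => u v; rewrite [in RHS]bil_add [in LHS]bil_inf_act !bil_add.
rewrite [X in _ = X + _]bil_inf_act [X in _ = _ + X]bil_inf_act mulmxDr.
by rewrite !opprD [RHS]addrACA; congr (_ + _); rewrite [RHS]addrACA.
Qed.

Lemma inf_actZ a A x : inf_act A (a *: x) = a *: inf_act A x.
Proof.
apply: algV_eq => u v; rewrite [in RHS]bil_scale [in LHS]bil_inf_act !bil_scale.
rewrite [in RHS]bil_inf_act -scalemxAr.
by rewrite !scalerBr.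
Qed.

(** Equivariance under the adjoint action; it lets a Hermitian operator be replaced by a diagonal
    one. *)
Lemma act_inf_act g A x : g \in unitmx ->
  act g (inf_act A x) = inf_act (g *m A *m invmx g) (act g x).
Proof.
move=> ug; apply: algV_eq => u v.
rewrite !(bil_act, bil_inf_act) !mulmxBr -!mulmxA !(mulmxA (invmx g) g).
by rewrite (mulVmx ug) !mul1mx.
Qed.

(** The inner product of V_n for the standard product of C^n. Other orthonormal bases are reached by
    first acting with the inverse of their matrix. *)
Definition ip x y : C := \sum_i \sum_j dotc (x (i, j)) (y (i, j)).

Lemma ipC x y : ip x y = (ip y x)^*.
Proof.
rewrite rmorph_sum; apply: eq_bigr => i _; rewrite rmorph_sum.
by apply: eq_bigr => j _; exact: dotcC.
Qed.

Lemma ipDl x y z : ip (x + y) z = ip x z + ip y z.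
Proof.
rewrite -big_split; apply: eq_bigr => i _; rewrite -big_split.
by apply: eq_bigr => j _; rewrite ffunE dotcDl.
Qed.

Lemma ipZl a x y : ip (a *: x) y = a * ip x y.
Proof.
rewrite mulr_sumr; apply: eq_bigr => i _; rewrite mulr_sumr.
by apply: eq_bigr => j _; rewrite ffunE dotcZl.
Qed.

Lemma ipBl x y z : ip (x - y) z = ip x z - ip y z.
Proof. by rewrite -scaleN1r ipDl ipZl mulN1r. Qed.

Lemma ipDr x y z : ip x (y + z) = ip x y + ip x z.
Proof. by rewrite ipC ipDl rmorphD /= -!ipC. Qed.

Lemma ipZr a x y : ip x (a *: y) = a^* * ip x y.
Proof. by rewrite ipC ipZl rmorphM /= -ipC. Qed.

Lemma ip_gt0 x : x != 0 -> 0 < ip x x.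
Proof.
move=> x0; have ge0 i j (l : 'I_n) : 0 <= x (i, j) l 0 * (x (i, j) l 0)^*.
  exact: mul_conjC_ge0.
rewrite lt0r sumr_ge0 ?andbT => [|i _]; last first.
  by apply: sumr_ge0 => j _; apply: sumr_ge0.
apply: contra x0 => /eqP ip0; apply/eqP/ffunP => -[i j]; rewrite ffunE.
apply/colP => l; rewrite mxE.
have ge0' a b : 0 <= dotc (x (a, b)) (x (a, b)) by apply: sumr_ge0.
have ip1 : \sum_j dotc (x (i, j)) (x (i, j)) = 0.
  by apply: (psumr_eq0P _ ip0) => // a _; apply: sumr_ge0.
have ip2 : dotc (x (i, j)) (x (i, j)) = 0 by apply: (psumr_eq0P _ ip1).
have /eqP : x (i, j) l 0 * (x (i, j) l 0)^* = 0 by apply: (psumr_eq0P _ ip2).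
by rewrite mul_conjC_eq0 => /eqP.
Qed.

(** Freezing one argument leaves a matrix, to which [sum_dotc_adj] applies. *)
Lemma bil_mulmxl x v : exists F, forall u, bil x u v = F *m u.
Proof.
exists (\matrix_(k, i) bil x (e_ i) v k 0) => u.
rewrite [u in LHS]cV_sum_delta linear_sumlz; apply/colP => k.
rewrite summxE mxE; apply: eq_bigr => i _.
by rewrite /= bilZl !mxE mulrC.
Qed.

Lemma bil_mulmxr x u : exists F, forall v, bil x u v = F *m v.
Proof.
exists (\matrix_(k, i) bil x u (e_ i) k 0) => v.
rewrite [v in LHS]cV_sum_delta linear_sumr; apply/colP => k.
rewrite summxE mxE; apply: eq_bigr => i _.
by rewrite /= bilZr !mxE mulrC.
Qed.

Lemma sum_dotc_bill x y A B v w :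
  \sum_i dotc (bil x (A *m e_ i) v) (bil y (B *m e_ i) w) =
  \sum_i dotc (bil x (e_ i) v) (bil y (B *m (A^t* *m e_ i)) w).
Proof.
have [F xF] := bil_mulmxl x v; have [G yG] := bil_mulmxl y w.
transitivity (\sum_i dotc (F *m (A *m e_ i)) (G *m B *m e_ i)).
  by apply: eq_bigr => i _; rewrite xF yG -mulmxA.
by rewrite sum_dotc_adj; apply: eq_bigr => i _; rewrite xF yG -mulmxA.
Qed.

Lemma sum_dotc_bilr x y A B v w :
  \sum_i dotc (bil x v (A *m e_ i)) (bil y w (B *m e_ i)) =
  \sum_i dotc (bil x v (e_ i)) (bil y w (B *m (A^t* *m e_ i))).
Proof.
have [F xF] := bil_mulmxr x v; have [G yG] := bil_mulmxr y w.
transitivity (\sum_i dotc (F *m (A *m e_ i)) (G *m B *m e_ i)).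
  by apply: eq_bigr => i _; rewrite xF yG -mulmxA.
by rewrite sum_dotc_adj; apply: eq_bigr => i _; rewrite xF yG -mulmxA.
Qed.

Lemma ipE x y : ip x y = \sum_i \sum_j dotc (bil x (e_ i) (e_ j)) (bil y (e_ i) (e_ j)).
Proof. by apply: eq_bigr => i _; apply: eq_bigr => j _; rewrite !bil_delta. Qed.

(** The adjoint passes through each of the three terms: through the output by [dotc_adj], through
    each input by [sum_dotc_adj]. *)
Lemma ip_inf_act A x y : ip (inf_act A x) y = ip x (inf_act (A^t*) y).
Proof.
have dotcBr u v w : dotc u (v - w) = dotc u v - dotc u w.
  by rewrite dotcC dotcBl rmorphB /= -!dotcC.
have El j : \sum_i dotc (bil x (A *m e_ i) (e_ j)) (y (i, j)) =
            \sum_i dotc (x (i, j)) (bil y (A^t* *m e_ i) (e_ j)).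
  have [F xF] := bil_mulmxl x (e_ j); have [G yG] := bil_mulmxl y (e_ j).
  transitivity (\sum_i dotc (F *m (A *m e_ i)) (G *m e_ i)).
    by apply: eq_bigr => i _; rewrite -(bil_delta y) xF yG.
  by rewrite sum_dotc_adj; apply: eq_bigr => i _; rewrite -(bil_delta x) xF yG.
have Er i : \sum_j dotc (bil x (e_ i) (A *m e_ j)) (y (i, j)) =
            \sum_j dotc (x (i, j)) (bil y (e_ i) (A^t* *m e_ j)).
  have [F xF] := bil_mulmxr x (e_ i); have [G yG] := bil_mulmxr y (e_ i).
  transitivity (\sum_j dotc (F *m (A *m e_ j)) (G *m e_ j)).
    by apply: eq_bigr => j _; rewrite -(bil_delta y) xF yG.
  by rewrite sum_dotc_adj; apply: eq_bigr => j _; rewrite -(bil_delta x) xF yG.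
transitivity (\sum_i \sum_j dotc (A *m x (i, j)) (y (i, j))
   - \sum_i \sum_j dotc (bil x (A *m e_ i) (e_ j)) (y (i, j))
   - \sum_i \sum_j dotc (bil x (e_ i) (A *m e_ j)) (y (i, j))).
  rewrite -!sumrB; apply: eq_bigr => i _; rewrite -!sumrB.
  by apply: eq_bigr => j _; rewrite ffunE /= !dotcBl.
rewrite (eq_bigr _ (fun i _ => Er i)) [X in _ - X - _]exchange_big /=.
rewrite (eq_bigr _ (fun j _ => El j)) [X in _ - X - _]exchange_big /=.
rewrite -!sumrB; apply: eq_bigr => i _; rewrite -!sumrB.
by apply: eq_bigr => j _; rewrite ffunE /= !dotcBr dotc_adj.
Qed.

(** The sum over basis vectors is a trace in each argument, so the unitary factors cancel one
    argument at a time. *)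
Lemma ip_unitary U x y : U \is unitarymx -> ip (act U x) (act U y) = ip x y.
Proof.
move=> uU; have U1 : U^t* *m U = 1%:M.
  by rewrite -invmx_unitary // mulVmx ?unitarymx_unit.
transitivity (\sum_i \sum_j dotc (bil x (U^t* *m e_ i) (U^t* *m e_ j))
                                (bil y (U^t* *m e_ i) (U^t* *m e_ j))).
  apply: eq_bigr => i _; apply: eq_bigr => j _.
  by rewrite !ffunE dotc_adj mulmxA U1 mul1mx invmx_unitary.
transitivity (\sum_i \sum_j dotc (bil x (U^t* *m e_ i) (e_ j))
                                (bil y (U^t* *m e_ i) (e_ j))).
  apply: eq_bigr => i _; rewrite sum_dotc_bilr; apply: eq_bigr => j _.
  by rewrite trmxCK [U^t* *m (_ *m _)]mulmxA U1 mul1mx.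
rewrite ipE exchange_big [RHS]exchange_big; apply: eq_bigr => j _ /=.
rewrite sum_dotc_bill; apply: eq_bigr => i _.
by rewrite trmxCK [U^t* *m (_ *m _)]mulmxA U1 mul1mx.
Qed.

(* [moment_form x x] represents A |-> 2 <A.x, x>, the differential of the
   squared norm along the orbit of x. *)
Definition moment_form x y : 'M[C]_n :=
  \matrix_(a, b) (2 * ip (inf_act (delta_mx b a) x) y).

(** Both sides are linear in [A], and on elementary matrices this is the definition; the trace
    pairing transposes the indices, hence [delta_mx b a] at entry (a, b). Keeping [x] and [y]
    distinct allows polarization later. *)
Lemma trace_moment_form x y A :
  \tr (moment_form x y *m A) = 2 * ip (inf_act A x) y.
Proof.
have ip_suml I (r : seq I) (F : I -> algV R n) :
    ip (\sum_(i <- r) F i) y = \sum_(i <- r) ip (F i) y.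
  elim: r => [|i r IH]; rewrite ?big_nil ?big_cons ?ipDl ?IH //.
  by rewrite -(scale0r 0) ipZl mul0r.
have inf_suml I (r : seq I) (F : I -> 'M[C]_n) :
    inf_act (\sum_(i <- r) F i) x = \sum_(i <- r) inf_act (F i) x.
  elim: r => [|i r IH]; rewrite ?big_nil ?big_cons ?inf_actDl ?IH //.
  by rewrite -(scale0r 0) inf_actZl scale0r.
rewrite [A in RHS]matrix_sum_delta inf_suml ip_suml mulr_sumr.
rewrite /mxtrace; under eq_bigr do rewrite mxE.
rewrite exchange_big; apply: eq_bigr => a _.
rewrite inf_suml ip_suml mulr_sumr; apply: eq_bigr => b _.
by rewrite mxE inf_actZl ipZl mulrCA mulrC.
Qed.

Lemma moment_form_hermitian x : (moment_form x x)^t* = moment_form x x.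
Proof.
apply/matrixP => a b; rewrite !mxE rmorphM /= -ipC conjC_nat; congr (_ * _).
have dE : (delta_mx b a)^t* = delta_mx a b :> 'M[C]_n.
  by apply/matrixP => i j; rewrite !mxE rmorph_nat andbC.
by rewrite ip_inf_act dE.
Qed.

Lemma moment_formD x y z : moment_form (x + y) z = moment_form x z + moment_form y z.
Proof. by apply/matrixP => a b; rewrite !mxE inf_actD ipDl mulrDr. Qed.

Lemma moment_formDr x y z : moment_form x (y + z) = moment_form x y + moment_form x z.
Proof. by apply/matrixP => a b; rewrite !mxE ipDr mulrDr. Qed.

Lemma moment_formZ a x y : moment_form (a *: x) y = a *: moment_form x y.
Proof. by apply/matrixP => i j; rewrite !mxE inf_actZ ipZl mulrCA. Qed.

Lemma moment_formZr a x y : moment_form x (a *: y) = a^* *: moment_form x y.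
Proof. by apply/matrixP => i j; rewrite !mxE ipZr mulrCA. Qed.

End InnerProduct.

(** * Differentiating the norm along an orbit *)

Section Derivatives.
Variable R : realType.
Local Notation C := R[i].
Local Notation Re := (@complex.Re R).

Lemma ReD (z w : C) : Re (z + w) = Re z + Re w.
Proof. by case: z; case: w. Qed.

Lemma ReZ (r : R) (z : C) : Re (r%:C * z) = r * Re z.
Proof. by case: z => a b /=; rewrite mul0r subr0. Qed.

Lemma Re_conjc (z : C) : Re z^* = Re z.
Proof. by case: z. Qed.

Lemma Re_sum I (r : seq I) (P : pred I) (F : I -> C) :
  Re (\sum_(i <- r | P i) F i) = \sum_(i <- r | P i) Re (F i).
Proof. by rewrite (big_morph Re ReD (erefl : Re 0 = 0)). Qed.

Lemma conj_real_complex (r : R) : (r%:C)^* = r%:C :> C.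
Proof. exact: conjc_real. Qed.

Lemma is_derive_sum_fct n (F : 'I_n -> R -> R) (dF : 'I_n -> R) (a : R) :
  (forall i, is_derive a (1 : R) (F i) (dF i)) ->
  is_derive a (1 : R) (fun t => \sum_i F i t) (\sum_i dF i).
Proof. by move=> dFi; rewrite -fct_sumE; exact: is_derive_sum. Qed.

Lemma is_derive_affine (c a b : R) : is_derive a (1 : R) (fun t => c + t * b) b.
Proof.
by apply: is_derive_eq; rewrite ?scaler0 !add0r mul1r; exact: mulr1.
Qed.

(** The factor by which the diagonal operator 1 + tD scales the squared modulus of a structure
    constant, [a] being the eigenvalue of the output and [b], [c] those of the inputs. *)
Lemma is_derive_ratio (a b c : R) :
  is_derive (0 : R) (1 : R)
    (fun t => ((1 + t * a) / ((1 + t * b) * (1 + t * c))) ^+ 2)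
    (2 * (a - b - c)).
Proof.
have dA := is_derive_affine 1 0.
have dV d := @is_deriveV R (fun t => 1 + t * d) 0 d 1.
have nz d : 1 + 0 * d != 0 :> R by rewrite mul0r addr0 oner_eq0.
rewrite (_ : (fun _ => _) =
    fun t => ((1 + t * a) * ((1 + t * b)^-1 * (1 + t * c)^-1)) ^+ 2); last first.
  by apply/funext => t; rewrite invfM.
have dVb := dV b (nz b) (dA b); have dVc := dV c (nz c) (dA c).
apply: is_derive_eq; rewrite !mul0r !addr0 expr1n invr1.
by rewrite /GRing.scale /=; ring.
Qed.

Lemma act_diag n (c : 'rV[C]_n) (y : algV R n) i j k : (forall l, c 0 l != 0) ->
  act (diag_mx c) y (i, j) k 0 = c 0 k / (c 0 i * c 0 j) * y (i, j) k 0.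
Proof.
move=> c0; have uc : diag_mx c \in unitmx.
  by rewrite unitmxE det_diag unitfE prodf_seq_neq0; apply/allP => l _ /=.
have De l : diag_mx c *m e_ l = c 0 l *: e_ l.
  apply/matrixP => a b; rewrite mul_diag_mx !mxE.
  by case: eqVneq => [->|]; rewrite ?mulr0.
have Ve l : invmx (diag_mx c) *m e_ l = (c 0 l)^-1 *: e_ l.
  apply: (can_inj (mulKmx uc)); rewrite mulKVmx // -scalemxAr De scalerA.
  by rewrite mulVf // scale1r.
rewrite ffunE !Ve bilZl bilZr bil_delta mul_diag_mx !mxE invfM.
by rewrite !mulrA.
Qed.

Lemma inf_act_diag n (c : 'rV[C]_n) (y : algV R n) i j k :
  inf_act (diag_mx c) y (i, j) k 0 = (c 0 k - c 0 i - c 0 j) * y (i, j) k 0.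
Proof.
have De l : diag_mx c *m e_ l = c 0 l *: e_ l.
  apply/matrixP => a b; rewrite mul_diag_mx !mxE.
  by case: eqVneq => [->|]; rewrite ?mulr0.
by rewrite ffunE /= !De bilZl bilZr !bil_delta mul_diag_mx !mxE !mulrBl.
Qed.

(** By the spectral theorem [A] is diagonal in a unitary basis, and [ip] is unitarily invariant. For
    diagonal [A] the squared norm is a sum of structure constants with explicit factors,
    differentiated termwise. *)
Lemma is_derive_ip_act n (x : algV R n) (A : 'M[C]_n) : A^t* = A ->
  is_derive (0 : R) (1 : R)
    (fun t => Re (ip (act (1%:M + t%:C *: A) x) (act (1%:M + t%:C *: A) x)))
    (Re (2 * ip (inf_act A x) x)).
Proof.
move=> AH; have Aherm : A \is hermsymmx by apply/is_hermitianmxP; rewrite expr0 scale1r AH.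
set P := spectralmx A; have uP : P \is unitarymx := spectral_unitarymx A.
have iP : P \in unitmx := unitarymx_unit uP.
have uP' : invmx P \is unitarymx by rewrite (invmx_unitary uP) (trmxC_unitary P).
have AE := orthomx_spectralP (hermitian_normalmx Aherm).
(* The eigenvalues of a Hermitian matrix are real, so their real parts lose nothing. *)
pose d l := Re (spectral_diag A 0 l); pose c : 'rV[C]_n := \row_l (d l)%:C.
have cE : spectral_diag A = c.
  apply/rowP => l; rewrite mxE RRe_real //.
  exact: (mxOverP (hermitian_spectral_diag_real Aherm)).
rewrite cE -/P in AE.
have two : 2 = (2 : R)%:C :> C by rewrite rmorph_nat.
pose y := act P x; pose m i j k := Re (y (i, j) k 0 * (y (i, j) k 0)^*).
have ReM (r : R) (z : C) : Re (r%:C * z * (r%:C * z)^*) = r ^+ 2 * Re (z * z^*).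
  by rewrite rmorphM /= conj_real_complex mulrACA -rmorphM ReZ.
have -> : Re (2 * ip (inf_act A x) x) =
    \sum_i \sum_j \sum_k 2 * (d k - d i - d j) * m i j k.
  rewrite -(ip_unitary _ _ uP) act_inf_act // {1}AE -/y.
  rewrite !mulmxA mulmxV // mul1mx -mulmxA mulmxV // mulmx1.
  rewrite mulr_sumr Re_sum; apply: eq_bigr => i _.
  rewrite mulr_sumr Re_sum; apply: eq_bigr => j _.
  rewrite mulr_sumr Re_sum; apply: eq_bigr => k _.
  by rewrite inf_act_diag !mxE -!rmorphB /= -[_ * _ * _^*]mulrA two !ReZ mulrA.
pose f i j k (t : R) :=
  ((1 + t * d k) / ((1 + t * d i) * (1 + t * d j))) ^+ 2 * m i j k.
(* The explicit sum is the squared norm only where 1 + tA is invertible, that is, where no 1 + t d_l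
   vanishes; this holds near t = 0. *)
apply: (@near_eq_is_derive _ _ _ (fun t => \sum_i \sum_j \sum_k f i j k t)); last first.
  apply: is_derive_sum_fct => i; apply: is_derive_sum_fct => j.
  apply: is_derive_sum_fct => k.
  have dr := is_derive_ratio (d k) (d i) (d j).
  apply: is_derive_eq; rewrite /GRing.scale /= mulr0; ring.
have : \forall t \near (0 : R), forall l, 1 + t * d l != 0.
  apply: (@filter_forall R 'I_n (fun l t => is_true (1 + t * d l != 0)) (nbhs (0 : R)) _) => l.
  have /derivable1_diffP/differentiable_continuous ct :=
    @ex_derive _ _ _ _ _ _ _ (is_derive_affine 1 0 (d l)).
  apply: (ct [set u | u != 0]); apply: open_nbhs_nbhs.
  split; first exact: open_neq.
  by rewrite /= mul0r addr0 oner_neq0.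
apply: filterS => t nz.
pose b : 'rV[C]_n := \row_l (1 + t * d l)%:C.
have b0 l : b 0 l != 0 by rewrite mxE fmorph_eq0.
have ub : diag_mx b \in unitmx.
  by rewrite unitmxE det_diag unitfE prodf_seq_neq0; apply/allP => l _ /=.
have -> : 1%:M + t%:C *: A = invmx P *m diag_mx b *m P.
  have -> : diag_mx b = 1%:M + t%:C *: diag_mx c.
    apply/matrixP => i j; rewrite !mxE rmorphD rmorphM rmorph1 mulrnDl.
    by rewrite mulrnAr.
  rewrite mulmxDr mulmx1 mulmxDl mulVmx // -scalemxAr -scalemxAl -AE //.
rewrite -actM ?unitmx_mul ?unitmx_inv ?iP // -actM ?unitmx_inv // ip_unitary //.
rewrite -/y Re_sum; apply: eq_bigr => i _.
rewrite Re_sum; apply: eq_bigr => j _; rewrite Re_sum; apply: eq_bigr => k _.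
by rewrite act_diag // !mxE -rmorphM -fmorphV -rmorphM /= ReM.
Qed.

End Derivatives.

(** * The moment map in an orthonormal basis *)

Lemma conj_invmxK (F : fieldType) n (B P : 'M[F]_n) : P \in unitmx ->
  invmx P *m (P *m B *m invmx P) *m P = B.
Proof.
by move=> iP; rewrite !mulmxA (mulVmx iP) mul1mx -mulmxA (mulVmx iP) mulmx1.
Qed.

Lemma trmxC_scale_real (R : realType) n (r : R) (A : 'M[R[i]]_n) :
  (r%:C *: A)^t* = r%:C *: A^t*.
Proof.
apply/matrixP => i j; rewrite !mxE rmorphM; congr (_ * _).
exact: conjc_real.
Qed.

Section Moment.
Variables (R : realType) (n : nat).
Local Notation C := R[i].
Local Notation Re := (@complex.Re R).
Variable (h : {dot 'cV[C]_n for Num.conj}).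
Implicit Types (mu : algV R n) (A B M P Q g : 'M[C]_n) (X : n.-tuple 'cV[C]_n).

(** An isometry from the standard product to [h]; its columns form an orthonormal basis, and
    [act (invmx P) mu] holds the structure constants of [mu] in it. *)
Definition unitary_frame P := forall u v, h (P *m u) (P *m v) = dotc u v.

Definition frame X : 'M[C]_n := \matrix_(i, j) tnth X j i 0.

Lemma frame_delta X j : frame X *m e_ j = tnth X j.
Proof. by rewrite -colE; apply/colP => i; rewrite !mxE. Qed.

Lemma frame_unitary X : orthonormal h X -> unitary_frame (frame X).
Proof.
move=> /orthonormalP[uX oX] u v.
have hX i j : h (tnth X i) (tnth X j) = (i == j)%:R.
  by rewrite oX ?mem_tnth // (inj_eq (tuple_uniqP _ uX)).
have fE w : frame X *m w = \sum_i w i 0 *: tnth X i.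
  rewrite {1}(cV_sum_delta w) mulmx_sumr; apply: eq_bigr => i _.
  by rewrite -scalemxAr frame_delta.
rewrite !fE linear_sumlz; apply: eq_bigr => i _.
rewrite linear_sumr (bigD1 i) //= big1 => [|j ji].
  by rewrite linearZl_LR linearZr_LR /= hX eqxx mulr1 addr0.
by rewrite linearZl_LR linearZr_LR /= hX eq_sym (negbTE ji) !mulr0.
Qed.

Lemma unitary_frame_unit P : unitary_frame P -> P \in unitmx.
Proof.
move=> uP; apply: unitmx_cV_inj => v Pv0.
have /eqP : dotc v v = 0 by rewrite -uP Pv0 linear0l.
rewrite psumr_eq0 => [/allP v0|k _]; last exact: mul_conjC_ge0.
apply/colP => k; have := v0 k (mem_index_enum _); rewrite mxE /= mul_conjC_eq0.
by move/eqP.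
Qed.

Lemma unitary_frame_change P Q : unitary_frame P -> unitary_frame Q ->
  invmx P *m Q \is unitarymx.
Proof.
move=> uP uQ; have iP := unitary_frame_unit uP.
apply: dotc_unitary => u v.
by rewrite -uP !mulmxA !(mulmxV iP) !mul1mx uQ.
Qed.

(** For the frame of [X] this is the definition, and two frames differ by a unitary matrix. Thus [P]
    may be chosen freely, adapted to [mu]. *)
Lemma normsqVE X P mu : orthonormal h X -> unitary_frame P ->
  normsqV h X mu = Re (ip (act (invmx P) mu) (act (invmx P) mu)).
Proof.
move=> oX uP; have uX := frame_unitary oX.
have iX := unitary_frame_unit uX; have iP := unitary_frame_unit uP.
have -> : act (invmx P) mu = act (invmx P *m frame X) (act (invmx (frame X)) mu).
  have uPX : invmx P *m frame X \in unitmx by rewrite unitmx_mul unitmx_inv iP.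
  have uX' : invmx (frame X) \in unitmx by rewrite unitmx_inv.
  by rewrite (actM _ uPX uX') (mulmxK iX).
rewrite ip_unitary; last exact: unitary_frame_change.
congr (Re _); apply: eq_bigr => i _; apply: eq_bigr => j _; apply: eq_bigr => k _.
rewrite -!frame_delta -[bil mu _ _](mulKVmx iX) !uX !dotc_e.
by rewrite ffunE invmxK.
Qed.

Lemma adjoint_frame P A u v : unitary_frame P ->
  h (A *m (P *m u)) (P *m v) = dotc (invmx P *m A *m P *m u) v.
Proof.
move=> uP; rewrite -uP; congr (h _ _).
by rewrite !mulmxA (mulmxV (unitary_frame_unit uP)) mul1mx.
Qed.

Lemma adjoint_framer P A u v : unitary_frame P ->
  h (P *m u) (A *m (P *m v)) = dotc u (invmx P *m A *m P *m v).
Proof.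
move=> uP; rewrite -uP; congr (h _ _).
by rewrite !mulmxA (mulmxV (unitary_frame_unit uP)) mul1mx.
Qed.

Lemma adjoint_opE P A : unitary_frame P ->
  invmx P *m adjoint_op h A *m P = (invmx P *m A *m P)^t*.
Proof.
move=> uP; have iP := unitary_frame_unit uP.
rewrite /adjoint_op; case: xgetP => [B _ AB|noB].
  apply: dotc_adj_unique => u v.
  by rewrite -(adjoint_frame _ _ _ uP) -(adjoint_framer _ _ _ uP) AB.
(* [xget] does not fall back on its default: the conjugate transpose taken in the frame is an
   adjoint. *)
case: (noB (P *m (invmx P *m A *m P)^t* *m invmx P)) => x y.
rewrite -[x](mulKVmx iP) -[y](mulKVmx iP).
by rewrite (adjoint_frame _ _ _ uP) (adjoint_framer _ _ _ uP) dotc_adj (conj_invmxK _ iP).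
Qed.

Lemma hermitian_opE P A : unitary_frame P ->
  hermitian_op h A <-> (invmx P *m A *m P)^t* = invmx P *m A *m P.
Proof.
move=> uP; have iP := unitary_frame_unit uP; split=> [Ah|Ah x y].
  apply/esym/dotc_adj_unique => u v.
  by rewrite -(adjoint_frame _ _ _ uP) -adjoint_framer.
rewrite -[x](mulKVmx iP) -[y](mulKVmx iP).
by rewrite (adjoint_frame _ _ _ uP) (adjoint_framer _ _ _ uP) dotc_adj Ah.
Qed.

Lemma innerME P A B : unitary_frame P ->
  innerM h A B = \tr (invmx P *m A *m P *m (invmx P *m B *m P)^t*).
Proof.
move=> uP; have iP := unitary_frame_unit uP.
have conjM (F G : 'M[C]_n) :
    invmx P *m F *m P *m (invmx P *m G *m P) = invmx P *m (F *m G) *m P.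
  by rewrite !mulmxA (mulmxK iP).
by rewrite -(adjoint_opE _ uP) conjM mxtrace_mulC (mulKVmx iP).
Qed.

(** Stated for every [g], since it is applied to 1 + tA for all t, including those where it is
    singular. *)
Lemma act_frame P g mu : P \in unitmx ->
  act (invmx P) (act g mu) = act (invmx P *m g *m P) (act (invmx P) mu).
Proof.
move=> iP; have VE : invmx (invmx P *m g *m P) = invmx P *m invmx g *m P.
  have [ug|nug] := boolP (g \in unitmx).
    by rewrite !invmxM ?unitmx_mul ?unitmx_inv ?iP // invmxK mulmxA.
  (* [invmx] leaves a singular matrix unchanged, so it still commutes with conjugation. *)
  rewrite [invmx g]invmx_out // invmx_out // inE.
  by rewrite !unitmx_mul unitmx_inv iP andbT.
have PK w : P *m (invmx P *m invmx g *m P *m w) = invmx g *m (P *m w).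
  by rewrite !mulmxA (mulmxV iP) mul1mx.
apply: algV_eq => u v; rewrite [in LHS]bil_act [in LHS]bil_act.
rewrite [in RHS]bil_act [in RHS]bil_act VE !invmxK !PK -[RHS]mulmxA.
by rewrite (mulKVmx iP) mulmxA.
Qed.

Lemma drhoE X P mu A : orthonormal h X -> unitary_frame P -> hermitian_op h A ->
  let nu := act (invmx P) mu in
  drho h X mu A = Re (2 * ip (inf_act (invmx P *m A *m P) nu) nu).
Proof.
move=> oX uP Ah nu; have iP := unitary_frame_unit uP.
have /(hermitian_opE A uP) Ah' := Ah.
rewrite /drho derive1E; set f := fun t => _.
have -> : f = fun t => Re (ip (act (1%:M + t%:C *: (invmx P *m A *m P)) nu)
                             (act (1%:M + t%:C *: (invmx P *m A *m P)) nu)).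
  apply/funext => t; rewrite /f /rho (normsqVE _ oX uP) (act_frame _ _ iP).
  by rewrite mulmxDr mulmx1 mulmxDl (mulVmx iP) -scalemxAr -scalemxAl.
by have := is_derive_ip_act nu Ah' => -[_ ->].
Qed.

Lemma ip_inf_act_real (x : algV R n) A : A^t* = A ->
  (Re (ip (inf_act A x) x))%:C = ip (inf_act A x) x.
Proof. by move=> Ah; rewrite RRe_real // CrealE -ipC ip_inf_act Ah. Qed.

(** The matrix on the right satisfies both defining conditions, so the moment map is not the default
    value. The difference from any other solution is Hermitian, and testing it against itself shows
    that it vanishes. *)
Lemma moment_formE X P mu : orthonormal h X -> unitary_frame P ->
  let nu := act (invmx P) mu in
  invmx P *m moment h X mu *m P = (normsqV h X mu)^-1%:C *: moment_form nu nu.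
Proof.
move=> oX uP nu; have iP := unitary_frame_unit uP.
set a := normsqV _ _ _; set N := _ *: moment_form _ _.
have NH : N^t* = N.
  by rewrite /N trmxC_scale_real moment_form_hermitian.
have PN B := conj_invmxK B iP.
have trN A : hermitian_op h A ->
    \tr (N *m (invmx P *m A *m P)) = (drho h X mu A / a)%:C.
  move=> Ah; rewrite (drhoE mu oX uP Ah) -scalemxAl mxtraceZ trace_moment_form.
  have /(hermitian_opE A uP) Ah' := Ah.
  rewrite mulrC rmorphM /=; congr (_ * _).
  rewrite -(ip_inf_act_real _ Ah') (_ : 2 = (2 : R)%:C); last by rewrite rmorph_nat.
  by rewrite ReZ -!rmorphM.
rewrite /moment; case: xgetP => [M _ [MH MA]|noM]; last first.
  case: (noM (P *m N *m invmx P)); split; first by apply/(hermitian_opE _ uP); rewrite PN.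
  by move=> A Ah; rewrite (innerME _ _ uP) PN; move/(hermitian_opE _ uP): (Ah) => ->; exact: trN.
have /(hermitian_opE _ uP) MH' := MH.
set D := invmx P *m M *m P - N.
have DH : D^t* = D by rewrite /D raddfB /= map_mxB MH' NH.
have DD : \tr (D *m D^t*) = 0.
  (* The difference [D] is itself an admissible test operator. *)
  have Bh : hermitian_op h (P *m D *m invmx P) by apply/(hermitian_opE _ uP); rewrite PN.
  have := MA _ Bh; rewrite (innerME _ _ uP) PN -(trN _ Bh) PN DH => E.
  by rewrite {1}/D mulmxBl raddfB /= E subrr.
apply/eqP; rewrite -subr_eq0 -/D; apply/eqP/matrixP => i j; rewrite [RHS]mxE.
move/eqP: DD; rewrite /mxtrace psumr_eq0 => [/allP/(_ i (mem_index_enum _))|k _] /=; last first.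
  by rewrite mxE sumr_ge0 // => l _; rewrite !mxE mul_conjC_ge0.
rewrite mxE psumr_eq0 => [/allP/(_ j (mem_index_enum _))|k _] /=; last first.
  by rewrite !mxE mul_conjC_ge0.
by rewrite [_^t* _ _]mxE [_^T _ _]mxE mul_conjC_eq0 => /eqP.
Qed.

Lemma FnE X P mu : orthonormal h X -> unitary_frame P ->
  let nu := act (invmx P) mu in let N := moment_form nu nu in
  Fn h X mu = Re (\tr (N *m N)) / Re (ip nu nu) ^+ 2.
Proof.
move=> oX uP nu N; rewrite /Fn (innerME _ _ uP) (moment_formE _ oX uP).
rewrite trmxC_scale_real moment_form_hermitian.
rewrite -scalemxAl -scalemxAr scalerA mxtraceZ -rmorphM /= ReZ (normsqVE mu oX uP).
by rewrite mulrC -expr2 exprVn.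
Qed.

End Moment.

(** * Critical points of F_n *)

Section Critical.
Variables (R : realType) (n : nat).
Local Notation C := R[i].
Local Notation Re := (@complex.Re R).
Implicit Types (mu nu w : algV R n) (A B : 'M[C]_n).

(** Along a line F_n is a quartic over the square of a quadratic; at 0 only the constant and linear
    coefficients contribute. *)
Lemma is_derive_quartic_ratio (a b c d e p q r : R) : p != 0 ->
  is_derive (0 : R) (1 : R)
    (fun t => (a + t * b + t ^+ 2 * c + t ^+ 3 * d + t ^+ 4 * e) /
              (p + t * q + t ^+ 2 * r) ^+ 2)
    ((b * p - 2 * a * q) / p ^+ 3).
Proof.
move=> p0.
have dden : is_derive (0 : R) (1 : R) (fun t => (p + t * q + t ^+ 2 * r) ^+ 2) (2 * p * q).
  by apply: is_derive_eq; rewrite /GRing.scale /=; ring.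
have den0 : (p + 0 * q + 0 ^+ 2 * r) ^+ 2 != 0.
  by rewrite mul0r expr0n mul0r !addr0 expf_neq0.
have dinv := @is_deriveV R _ 0 _ 1 den0 dden.
apply: is_derive_eq; rewrite /GRing.scale /= !expr0n /= !mul0r !addr0.
by field.
Qed.

Lemma Re_trace_sqr_quadratic A B (D : 'M[C]_n) (t : R) :
  let M := A + t%:C *: B + (t ^+ 2)%:C *: D in
  Re (\tr (M *m M)) =
  Re (\tr (A *m A)) + t * (2 * Re (\tr (B *m A)))
  + t ^+ 2 * (2 * Re (\tr (D *m A)) + Re (\tr (B *m B)))
  + t ^+ 3 * (2 * Re (\tr (D *m B))) + t ^+ 4 * Re (\tr (D *m D)).
Proof.
pose T (F G : 'M[C]_n) := Re (\tr (F *m G)).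
have TDl F G H : T (F + G) H = T F H + T G H by rewrite /T mulmxDl mxtraceD ReD.
have TZl (r : R) F H : T (r%:C *: F) H = r * T F H.
  by rewrite /T -scalemxAl mxtraceZ ReZ.
have TC F G : T F G = T G F by rewrite /T mxtrace_mulC.
have TDr F G H : T H (F + G) = T H F + T H G by rewrite TC TDl !(TC _ H).
have TZr (r : R) F H : T H (r%:C *: F) = r * T H F by rewrite TC TZl (TC _ H).
rewrite /= -![Re (\tr _)]/(T _ _) (TC B A) (TC D A) (TC D B).
(* Forgetting the body of [T] leaves atoms for [ring]. *)
move: T TDl TZl TC TDr TZr => T TDl TZl TC TDr TZr.
rewrite !TDl !TDr !TZl !TZr (TC B A) (TC D A) (TC D B); ring.
Qed.

(** The moment matrix is quadratic in its argument, with polarization [N1], so trace and norm become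
    polynomials in t. *)
Lemma is_derive_moment_energy nu w : nu != 0 ->
  let N x := moment_form x x in
  is_derive (0 : R) (1 : R)
    (fun t => let x := nu + t%:C *: w in
              Re (\tr (N x *m N x)) / Re (ip x x) ^+ 2)
    (8 * (Re (ip (inf_act (N nu) nu) w) * Re (ip nu nu)
          - Re (ip (inf_act (N nu) nu) nu) * Re (ip nu w)) / Re (ip nu nu) ^+ 3).
Proof.
move=> nu0 N; set p := Re (ip nu nu).
have p0 : p != 0.
  by have := ip_gt0 nu0; rewrite ltcE => /andP[_ /lt0r_neq0].
pose N1 := moment_form nu w + moment_form w nu.
have NE t : N (nu + t%:C *: w) = N nu + t%:C *: N1 + (t ^+ 2)%:C *: N w.
  have ct : (t%:C)^* = t%:C :> C by exact: conjc_real.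
  rewrite /N moment_formD !moment_formDr !moment_formZ !moment_formZr ct.
  by rewrite scalerDr scalerA -rmorphM -expr2 !addrA.
have pE t : Re (ip (nu + t%:C *: w) (nu + t%:C *: w)) =
    p + t * (2 * Re (ip nu w)) + t ^+ 2 * Re (ip w w).
  have ct : (t%:C)^* = t%:C :> C by exact: conjc_real.
  rewrite ipDl !ipDr !ipZl !ipZr ct !ReD !ReZ (ipC w nu) Re_conjc -/p; ring.
pose T (F G : 'M[C]_n) := Re (\tr (F *m G)).
have -> : (fun t => let x := nu + t%:C *: w in
                    Re (\tr (N x *m N x)) / Re (ip x x) ^+ 2) =
  fun t => (T (N nu) (N nu) + t * (2 * T N1 (N nu))
            + t ^+ 2 * (2 * T (N w) (N nu) + T N1 N1)
            + t ^+ 3 * (2 * T (N w) N1) + t ^+ 4 * T (N w) (N w)) /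
           (p + t * (2 * Re (ip nu w)) + t ^+ 2 * Re (ip w w)) ^+ 2.
  by apply/funext => t; rewrite /= NE Re_trace_sqr_quadratic pE.
have dq := is_derive_quartic_ratio (T (N nu) (N nu)) (2 * T N1 (N nu))
  (2 * T (N w) (N nu) + T N1 N1) (2 * T (N w) N1) (T (N w) (N w))
  (2 * Re (ip nu w)) (Re (ip w w)) p0.
apply: (is_derive_eq dq); rewrite {dq NE pE}/T.
(* The two halves of [N1] contribute 2 <N.nu, w> and 2 <N.w, nu>. They have the same real part,
   because N is Hermitian and so acts self-adjointly. *)
have -> : Re (\tr (N1 *m N nu)) = 4 * Re (ip (inf_act (N nu) nu) w).
  have two : 2 = (2 : R)%:C :> C by rewrite rmorph_nat.
  rewrite mulmxDl mxtraceD !trace_moment_form ReD two !ReZ.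
  rewrite (ip_inf_act _ w) moment_form_hermitian (ipC w) Re_conjc; ring.
have -> : Re (\tr (N nu *m N nu)) = 2 * Re (ip (inf_act (N nu) nu) nu).
  have two : 2 = (2 : R)%:C :> C by rewrite rmorph_nat.
  by rewrite trace_moment_form two ReZ.
congr (_ / _); ring.
Qed.

Variable (h : {dot 'cV[C]_n for Num.conj}) (X : n.-tuple 'cV[C]_n).
Hypothesis oX : orthonormal h X.

Lemma is_derive_Fn P mu v : unitary_frame h P -> mu != 0 ->
  let nu := act (invmx P) mu in let w := act (invmx P) v in
  let N := moment_form nu nu in
  is_derive (0 : R) (1 : R) (fun t => Fn h X (mu + t%:C *: v))
    (8 * (Re (ip (inf_act N nu) w) * Re (ip nu nu)
          - Re (ip (inf_act N nu) nu) * Re (ip nu w)) / Re (ip nu nu) ^+ 3).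
Proof.
move=> uP mu0 nu w N; have iP := unitary_frame_unit uP.
have nu0 : nu != 0.
  apply: contra mu0 => /eqP nu0; apply/eqP.
  by rewrite -(actVK mu iP) -/nu nu0 act0.
have := is_derive_moment_energy w nu0; congr (is_derive _ _ _ _).
by apply/funext => t; rewrite (FnE _ oX uP) actDZ.
Qed.

Lemma critical_PV_eigen P mu (c : R) : unitary_frame h P -> mu != 0 ->
  let nu := act (invmx P) mu in
  inf_act (moment_form nu nu) nu = c%:C *: nu -> critical_PV h X mu.
Proof.
move=> uP mu0 nu E; split=> // v; apply: is_derive_eq (is_derive_Fn v uP mu0) _.
have zE w : Re (ip (inf_act (moment_form nu nu) nu) w) = c * Re (ip nu w).
  by rewrite E ipZl ReZ.
have cancel (x y z : R) : 8 * (c * x * y - c * y * x) / z = 0.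
  by rewrite [c * x * y]mulrAC subrr mulr0 mul0r.
rewrite /= [X in X * _ - _]zE [X in _ - X * _]zE.
exact: cancel.
Qed.

Lemma critical_PV_orthogonal P mu w : unitary_frame h P ->
  let nu := act (invmx P) mu in let N := moment_form nu nu in
  critical_PV h X mu ->
  Re (ip (inf_act N nu) w) * Re (ip nu nu) = Re (ip (inf_act N nu) nu) * Re (ip nu w).
Proof.
move=> uP nu N [mu0 cr]; have iP := unitary_frame_unit uP.
have iP' : invmx P \in unitmx by rewrite unitmx_inv.
have nu0 : nu != 0.
  apply: contra mu0 => /eqP nu0; apply/eqP.
  by rewrite -(actVK mu iP) -/nu nu0 act0.
have p0 : Re (ip nu nu) != 0.
  by have := ip_gt0 nu0; rewrite ltcE => /andP[_ /lt0r_neq0].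
(* The direction [act P w] reads as [w] in the frame. *)
have [_ d1] := is_derive_Fn (act P w) uP mu0.
have [_ d0] := cr (act P w); move: d1; rewrite d0 /= (actK w iP) -/nu -/N => /esym/eqP.
rewrite !mulf_eq0 invr_eq0 expf_eq0 (negbTE p0) andbF orbF pnatr_eq0 /= subr_eq0.
by move/eqP.
Qed.

End Critical.

(** * Algebras whose products lie on a coordinate line *)

Section LineAlgebras.
Variables (R : realType) (n : nat) (o : 'I_n).
Local Notation C := R[i].
Implicit Types (A g K L : 'M[C]_n) (u v w : 'cV[C]_n).

(** Products K(u, v) e_o for a bilinear form K. All the normal forms below are of this type, which
    reduces V_n to matrices. *)
Definition line_alg K : algV R n := [ffun p => K p.1 p.2 *: e_ o].

Lemma bil_line_alg K u v : bil (line_alg K) u v = (u^T *m K *m v) 0 0 *: e_ o.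
Proof.
rewrite /bil [in RHS]mxE scaler_suml exchange_big; apply: eq_bigr => j _ /=.
rewrite mxE mulr_suml scaler_suml; apply: eq_bigr => i _.
by rewrite ffunE mxE scalerA mulrAC.
Qed.

(** Only the e_o coordinate of the action pairs with an algebra valued in that line, so [A] need not
    preserve the line. *)
Lemma line_alg_ip_inf_act A K L : ip (inf_act A (line_alg K)) (line_alg L) =
  A o o * \tr (K *m L^t*) - \tr ((A^T *m K + K *m A) *m L^t*).
Proof.
have tE F : \tr (F *m L^t*) = \sum_i \sum_j F i j * (L i j)^*.
  by apply: eq_bigr => i _; rewrite mxE; apply: eq_bigr => j _; rewrite !mxE.
rewrite !tE mulr_sumr -sumrB; apply: eq_bigr => i _.
rewrite mulr_sumr -sumrB; apply: eq_bigr => j _.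
have lE F : line_alg F (i, j) = F i j *: e_ o by rewrite ffunE.
have dotcZr u a : dotc u (a *: e_ o) = a^* * u o 0.
  by rewrite dotcC dotcZl rmorphM /= -dotcC dotc_e.
have formE (F : 'M[C]_n) : ((e_ i : 'cV_n)^T *m F *m (e_ j : 'cV_n)) 0 0 = F i j.
  by rewrite -colE mxE trmx_delta -rowE mxE.
have inf_o : inf_act A (line_alg K) (i, j) o 0 =
    A o o * K i j - (A^T *m K) i j - (K *m A) i j.
  rewrite ffunE lE /= !bil_line_alg trmx_mul -[_ *m A^T *m K]mulmxA formE.
  rewrite mulmxA -[_ *m K *m A]mulmxA formE -scalemxAr -colE !mxE !eqxx !mulr1.
  by rewrite mulrC.
have addE (F G : 'M[C]_n) : (F + G) i j = F i j + G i j by rewrite mxE.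
by rewrite lE dotcZr inf_o addE; ring.
Qed.

Lemma line_alg_inf_act A K (a : C) : A *m (e_ o : 'cV_n) = a *: e_ o ->
  inf_act A (line_alg K) = line_alg (a *: K - A^T *m K - K *m A).
Proof.
move=> Ao; apply: algV_eq => u v; rewrite bil_inf_act !bil_line_alg.
rewrite -scalemxAr Ao scalerA -!scalerBl; congr (_ *: _).
rewrite !(mulmxBr, mulmxBl) -scalemxAr -scalemxAl trmx_mul !mulmxA !mxE.
by rewrite [in LHS]mulrC.
Qed.

Lemma line_alg_ip K L : ip (line_alg K) (line_alg L) = \tr (K *m L^t*).
Proof.
apply: eq_bigr => i _; rewrite mxE; apply: eq_bigr => j _.
by rewrite !ffunE dotcC dotcZl dotcC dotcZl dotc_e !mxE !eqxx mulr1 rmorphM /= conjCK mulrC.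
Qed.

Lemma line_alg_moment K (a b : 'I_n) :
  let x := line_alg K in
  moment_form x x a b = 2 * (((a == o) && (b == o))%:R * \tr (K *m K^t*)
    - (K *m K^t*) b a - (K^t* *m K) a b).
Proof.
rewrite /= mxE line_alg_ip_inf_act; congr (_ * _).
have trE (F : 'M[C]_n) i j : \tr (delta_mx i j *m F) = F j i.
  rewrite /mxtrace (bigD1 i) //= big1 ?addr0 => [|k ki].
    rewrite mxE (bigD1 j) //= big1 ?addr0 => [|l lj]; rewrite mxE ?eqxx ?mul1r //.
    by rewrite andbC (negbTE lj) mul0r.
  by rewrite mxE big1 // => l _; rewrite mxE (negbTE ki) mul0r.
rewrite mulmxDl mxtraceD trmx_delta -!mulmxA trE (mxtrace_mulC K (_ *m _)) -mulmxA trE opprD addrA.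
by rewrite mxE (eq_sym o b) (eq_sym o a) andbC.
Qed.

(** When [g] preserves the line, the form changes by congruence and by the scalar of [g] on the
    line. *)
Lemma line_alg_act g K (a : C) : g \in unitmx -> g *m (e_ o : 'cV_n) = a *: e_ o ->
  act g (line_alg K) = line_alg (a *: ((invmx g)^T *m K *m invmx g)).
Proof.
move=> ug go; apply: algV_eq => u v; rewrite bil_act !bil_line_alg.
rewrite -scalemxAr go scalerA -!scalemxAr -!scalemxAl [in RHS]mxE [in RHS]mulrC.
by rewrite trmx_mul !mulmxA.
Qed.

End LineAlgebras.

(** * A non-critical orbit in dimension 3 *)

(** QR decomposition, by the Gram-Schmidt process on the columns of [g], that is, the rows of its
    transpose. *)
Lemma unitary_upper_factor (C : numClosedFieldType) n (g : 'M[C]_n) :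
  exists Q S : 'M[C]_n, [/\ Q \is unitarymx, g = Q *m S &
    forall i j : 'I_n, (j < i)%N -> S i j = 0].
Proof.
pose B := schmidt g^T; have uB : B \is unitarymx by exact: schmidt_unitarymx.
exists B^T, (map_mx Num.conj B *m g); split.
- by rewrite trmx_unitary.
- have /mulmx1C BB := unitarymxP uB; rewrite mulmxA.
  have -> : B^T *m map_mx Num.conj B = (B^t* *m B)^T.
    by rewrite trmx_mul map_trmx trmxK.
  by rewrite BB trmx1 mul1mx.
move=> i j ji.
(* Column j of [g] lies in the span of the first Gram-Schmidt vectors up to j, all orthogonal to the
   i-th since j < i. *)
have sub0 : (row j g^T <= kermx ((row i B)^t*))%MS.
  apply: submx_trans (row_schmidt_sub g^T j) _; apply/sumsmx_subP => k kj.
  rewrite genmxE; apply/sub_kermxP.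
  have := unitarymxP uB => /matrixP/(_ k i); rewrite [RHS]mxE.
  rewrite (_ : (k == i) = false); last by apply/negbTE; rewrite neq_ltn (leq_ltn_trans kj ji).
  move=> BB; apply/matrixP => a b; rewrite [RHS]mxE -[RHS]BB !mxE.
  by apply: eq_bigr => l _; rewrite !mxE.
have /sub_kermxP/matrixP/(_ 0 0) := sub0; rewrite [RHS]mxE => E.
rewrite -[RHS]E !mxE; apply: eq_bigr => l _; rewrite !mxE mulrC //.
Qed.

(** The line of products lies in both radicals of the form, so every triple product is zero. *)
Lemma line_alg_symmetric_Leibniz (R : realType) n (o : 'I_n) (K : 'M[R[i]]_n) :
  K *m (e_ o : 'cV_n) = 0 -> (e_ o : 'cV_n)^T *m K = 0 ->
  symmetric_Leibniz (line_alg o K).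
Proof.
move=> Kr Kl x y z.
have b0l a v : bil (line_alg o K) (a *: e_ o) v = 0.
  by rewrite bil_line_alg linearZ /= -!scalemxAl Kl mul0mx scaler0 mxE scale0r.
have b0r a u : bil (line_alg o K) u (a *: e_ o) = 0.
  by rewrite bil_line_alg -scalemxAr -mulmxA Kr mulmx0 scaler0 mxE scale0r.
by rewrite [bil _ y z]bil_line_alg [bil _ x y]bil_line_alg [bil _ x z]bil_line_alg
  !b0l !b0r addr0.
Qed.

Local Notation i0 := (@Ordinal 3 0 isT).
Local Notation i1 := (@Ordinal 3 1 isT).
Local Notation i2 := (@Ordinal 3 2 isT).

(** * The three-dimensional form: traces and triangular congruences *)

Section DegenerateForm.
Variable C : numClosedFieldType.
Implicit Types (K L N F G : 'M[C]_3) (s a : C).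

Lemma sum3 (V : nmodType) (F : 'I_3 -> V) : \sum_i F i = F i0 + F i1 + F i2.
Proof.
by rewrite !big_ord_recr big_ord0 /= add0r; congr (F _ + F _ + F _); exact: val_inj.
Qed.

Lemma ord3_cases (P : 'I_3 -> Prop) : P i0 -> P i1 -> P i2 -> forall i, P i.
Proof.
by move=> P0 P1 P2 [[|[|[|//]]] lt_i]; [have := P0|have := P1|have := P2];
  congr P; apply: val_inj.
Qed.

(** With values on e0: e2 e2 = s e0 is the symmetric part and e2 e1 = - e1 e2 = a e0 the skew
    part. *)
Definition degenerate_form (s a : C) : 'M[C]_3 :=
  s *: delta_mx i2 i2 + a *: (delta_mx i2 i1 - delta_mx i1 i2).

(** A tuple of equations, so that a single rewrite evaluates every entry of a matrix known only
    entrywise. *)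
Definition degenerate_entries K s a : Prop :=
  ((K i0 i0 = 0) * (K i0 i1 = 0) * (K i0 i2 = 0) *
   (K i1 i0 = 0) * (K i1 i1 = 0) * (K i1 i2 = - a) *
   (K i2 i0 = 0) * (K i2 i1 = a) * (K i2 i2 = s))%type.

Lemma degenerate_formE s a : degenerate_entries (degenerate_form s a) s a.
Proof.
by rewrite /degenerate_form; do !split; rewrite !mxE /= ?mulr0 ?mulr1 ?subr0 ?sub0r
  ?mulr0 ?mulrN1 ?add0r ?addr0 ?mulr1.
Qed.

(** [L] is the symmetric part of [K]. The diagonal of N is 2(p + 2q), -4q, -4(p + q), so N scales
    the symmetric coefficient by 10p + 12q and the skew one by 6p + 12q; as these differ by 4p, no
    eigenvector results. *)
Lemma degenerate_form_traces K L N s a :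
  degenerate_entries K s a -> degenerate_entries L s 0 ->
  (forall i j, N i j = 2 * (((i == i0) && (j == i0))%:R * \tr (K *m K^t*)
    - (K *m K^t*) j i - (K^t* *m K) i j)) ->
  let p := s * s^* in let q := a * a^* in
  [/\ N i0 i0 * \tr (K *m L^t*) - \tr ((N^T *m K + K *m N) *m L^t*)
        = 2 * (5 * p + 6 * q) * p,
      N i0 i0 * \tr (K *m K^t*) - \tr ((N^T *m K + K *m N) *m K^t*)
        = 2 * (5 * p ^+ 2 + 12 * p * q + 12 * q ^+ 2),
      \tr (K *m K^t*) = p + 2 * q & \tr (K *m L^t*) = p].
Proof.
move=> KE LE NE p q.
have trK F G : \tr (F *m G^t*) =
    F i0 i0 * (G i0 i0)^* + F i0 i1 * (G i0 i1)^* + F i0 i2 * (G i0 i2)^* +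
   (F i1 i0 * (G i1 i0)^* + F i1 i1 * (G i1 i1)^* + F i1 i2 * (G i1 i2)^*) +
   (F i2 i0 * (G i2 i0)^* + F i2 i1 * (G i2 i1)^* + F i2 i2 * (G i2 i2)^*).
  by rewrite /mxtrace sum3 !mxE !sum3 !mxE.
have mulE F G i j : (F *m G) i j = F i i0 * G i0 j + F i i1 * G i1 j + F i i2 * G i2 j.
  by rewrite mxE sum3.
have ctE F i j : (F^t*) i j = (F j i)^* by rewrite !mxE.
have KK : \tr (K *m K^t*) = p + 2 * q.
  by rewrite trK !KE !rmorph0 !rmorphN /p /q; ring.
have KL : \tr (K *m L^t*) = p.
  by rewrite trK !KE !LE !(rmorph0, oppr0) /p; ring.
have N00 : N i0 i0 = 2 * (p + 2 * q).
  by rewrite NE KK !mulE !ctE !KE !rmorph0 /=; ring.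
have N11 : N i1 i1 = - (4 * q).
  by rewrite NE !mulE !ctE !KE !rmorph0 !rmorphN /= /q; ring.
have N22 : N i2 i2 = - (4 * (p + q)).
  by rewrite NE !mulE !ctE !KE !rmorph0 !rmorphN /= /p /q; ring.
have N12 : N i1 i2 = 0.
  by rewrite NE !mulE !ctE !KE !rmorph0 !rmorphN /= /p /q; ring.
have N21 : N i2 i1 = 0.
  by rewrite NE !mulE !ctE !KE !rmorph0 !rmorphN /= /p /q; ring.
have aE F G i j : (F + G) i j = F i j + G i j by rewrite mxE.
have tE F i j : F^T i j = F j i by rewrite mxE.
split=> //.
- rewrite KL trK !LE !(rmorph0, oppr0) !mulr0 !add0r !(aE, mulE, tE) !KE N00 N22 N12.
  by rewrite /p /q; ring.
- rewrite KK trK !KE !(rmorph0, rmorphN) !mulr0 !add0r !(aE, mulE, tE) !KE.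
  by rewrite N00 N11 N22 N12 N21 /p /q; ring.
Qed.

(** The inverse [W] of an upper triangular matrix is upper triangular with nonzero diagonal, and
    congruence by it keeps the shape of the form. *)
Lemma degenerate_entries_congr (S W : 'M[C]_3) :
  S *m W = 1%:M -> W *m S = 1%:M -> (forall i j : 'I_3, (j < i)%N -> S i j = 0) ->
  exists s a, [/\ s != 0, a != 0 &
    degenerate_entries (S i0 i0 *: (W^T *m degenerate_form 1 1 *m W)) s a].
Proof.
move=> SW WS S0.
have mulE F G i j : (F *m G) i j = F i i0 * G i0 j + F i i1 * G i1 j + F i i2 * G i2 j.
  by rewrite mxE sum3.
have S10 : S i1 i0 = 0 by exact: S0.
have S20 : S i2 i0 = 0 by exact: S0.
have S21 : S i2 i1 = 0 by exact: S0.
have WSE i j : (W *m S) i j = (i == j)%:R by rewrite WS mxE.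
have nz00 : S i0 i0 * W i0 i0 = 1.
  by have := WSE i0 i0; rewrite mulE S10 S20 !mulr0 !addr0 mulrC.
have S00 : S i0 i0 != 0.
  by apply: contra_eq_neq nz00 => ->; rewrite mul0r eq_sym oner_eq0.
have W10 : W i1 i0 = 0.
  by have /eqP := WSE i1 i0; rewrite mulE S10 S20 !mulr0 !addr0 mulf_eq0 (negbTE S00) orbF => /eqP.
have W20 : W i2 i0 = 0.
  by have /eqP := WSE i2 i0; rewrite mulE S10 S20 !mulr0 !addr0 mulf_eq0 (negbTE S00) orbF => /eqP.
have nz11 : W i1 i1 * S i1 i1 = 1.
  by have := WSE i1 i1; rewrite mulE W10 S21 mul0r mulr0 add0r addr0.
have S11 : S i1 i1 != 0.
  by apply: contra_eq_neq nz11 => ->; rewrite mulr0 eq_sym oner_eq0.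
have W11 : W i1 i1 != 0.
  by apply: contra_eq_neq nz11 => ->; rewrite mul0r eq_sym oner_eq0.
have W21 : W i2 i1 = 0.
  have /eqP := WSE i2 i1; rewrite mulE W20 S21 mul0r mulr0 add0r addr0 mulf_eq0.
  by rewrite (negbTE S11) orbF => /eqP.
have W22 : W i2 i2 != 0.
  have := WSE i2 i2; rewrite mulE W20 W21 !mul0r !add0r => nz22.
  by apply: contra_eq_neq nz22 => ->; rewrite mul0r eq_sym oner_eq0.
(* Entries (2, 2) and (2, 1) of the congruent form; in the former the skew contributions of
   [W i1 i2] cancel. *)
exists (S i0 i0 * W i2 i2 ^+ 2), (S i0 i0 * (W i2 i2 * W i1 i1)).
split; rewrite ?mulf_neq0 ?expf_neq0 //.
have KE := degenerate_formE 1 1.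
have ZE i j : (S i0 i0 *: (W^T *m degenerate_form 1 1 *m W)) i j = S i0 i0 *
    (W i2 i * W i2 j + W i2 i * W i1 j - W i1 i * W i2 j).
  by rewrite mxE !mulE !KE [W^T i i1]mxE [W^T i i2]mxE; ring.
by do !split; rewrite ZE ?W10 ?W20 ?W21; ring.
Qed.

End DegenerateForm.

(** * The orbit without critical points *)

Section Dim3.
Variable R : realType.
Local Notation C := R[i].
Local Notation Re := (@complex.Re R).

Lemma degenerate_form_not_critical (h : {dot 'cV[C]_3 for Num.conj})
    (X : 3.-tuple 'cV[C]_3) (P K : 'M[C]_3) (mu : algV R 3) (s a : C) :
  orthonormal h X -> unitary_frame h P -> degenerate_entries K s a ->
  s != 0 -> a != 0 -> act (invmx P) mu = line_alg i0 K -> ~ critical_PV h X mu.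
Proof.
move=> oX uP KE s0 a0 muE.
(* The test direction is the symmetric part of the algebra. *)
move/(critical_PV_orthogonal oX (line_alg i0 (degenerate_form s 0)) uP).
rewrite /= muE; set N := moment_form _ _.
have NE i j : N i j = _ := line_alg_moment i0 K i j.
have [T1 T2 T3 T4] := degenerate_form_traces KE (degenerate_formE s 0) NE.
rewrite !line_alg_ip_inf_act !line_alg_ip.
rewrite T1 T2 T3 T4.
pose p := Re (s * s^*); pose q := Re (a * a^*).
have pE : s * s^* = p%:C by rewrite RRe_real // realE mul_conjC_ge0.
have qE : a * a^* = q%:C by rewrite RRe_real // realE mul_conjC_ge0.
have p0 : p != 0.
  apply: contra s0 => /eqP pz; rewrite -mul_conjC_eq0; apply/eqP.
  by rewrite [LHS]pE pz.
have q0 : q != 0.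
  apply: contra a0 => /eqP qz; rewrite -mul_conjC_eq0; apply/eqP.
  by rewrite [LHS]qE qz.
rewrite pE qE.
have cn k : k%:R = (k%:R : R)%:C :> C by rewrite rmorph_nat.
rewrite !cn -!(rmorphM, rmorphD, rmorphXn) /= => E.
(* The difference of the two sides of the criticality identity, up to sign. *)
have : 8 * (p ^+ 2 * q) = 0.
  apply: (addIr (2 * (5 * p ^+ 2 + 12 * p * q + 12 * q ^+ 2) * p)).
  by rewrite add0r -[RHS]E; ring.
by move/eqP; rewrite !mulf_eq0 (negbTE p0) (negbTE q0) pnatr_eq0.
Qed.

Lemma exists_symmetric_Leibniz_not_critical (h : {dot 'cV[C]_3 for Num.conj})
    (X : 3.-tuple 'cV[C]_3) : orthonormal h X ->
  exists2 mu : algV R 3, in_S mu &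
    forall g : 'M[C]_3, g \in unitmx -> ~ critical_S h X (act g mu).
Proof.
move=> oX; have KE := degenerate_formE (1 : C) 1.
set K := degenerate_form _ _ in KE; exists (line_alg i0 K).
  split.
    apply/eqP => /ffunP/(_ (i2, i2)); rewrite !ffunE => /colP/(_ i0).
    rewrite [RHS]mxE [LHS]mxE KE mxE /= mulr1 => /eqP.
    by rewrite oner_eq0.
  apply: line_alg_symmetric_Leibniz; apply/matrixP => i j.
    rewrite -colE [LHS]mxE [RHS]mxE.
    by elim/ord3_cases: i; rewrite KE.
  rewrite trmx_delta -rowE [LHS]mxE [RHS]mxE.
  by elim/ord3_cases: j; rewrite KE.
move=> g ug [_].
have uX := frame_unitary oX; have iX := unitary_frame_unit uX.
(* Writing g = X Q S, the columns of X Q are again orthonormal, and in that basis the algebra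
   [act g mu] is the original one acted on by the triangular S. *)
have [Q [S [uQ gE S0]]] := unitary_upper_factor (invmx (frame X) *m g).
have iQ := unitarymx_unit uQ.
have uP : unitary_frame h (frame X *m Q).
  move=> u v; rewrite -!mulmxA uX dotc_adj mulmxA -(invmx_unitary uQ).
  by rewrite (mulVmx iQ) mul1mx.
have iP := unitary_frame_unit uP.
have SE : S = invmx (frame X *m Q) *m g.
  by rewrite (invmxM iX iQ) -mulmxA gE (mulKmx iQ).
have iS : S \in unitmx by rewrite SE unitmx_mul unitmx_inv iP.
have [s [a [s0 a0 Kt]]] := degenerate_entries_congr (mulmxV iS) (mulVmx iS) S0.
apply: (degenerate_form_not_critical oX uP Kt s0 a0).
have iP' : invmx (frame X *m Q) \in unitmx by rewrite unitmx_inv.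
rewrite (actM _ iP' ug) -SE; apply: line_alg_act => //.
(* The first column of an upper triangular matrix is a multiple of e0, so the line of products is
   preserved. *)
apply/colP => i; rewrite -colE !mxE.
case: eqVneq => [->|i0' ]; rewrite ?mulr1 // mulr0 S0 //.
by rewrite lt0n.
Qed.

End Dim3.

(** * Dimension 2 *)

Lemma in_S_act (R : realType) n (g : 'M[R[i]]_n) (mu : algV R n) :
  g \in unitmx -> in_S mu -> in_S (act g mu).
Proof.
move=> ug [mu0 sL]; split.
  by apply: contra_neq mu0 => g0; rewrite -(actK mu ug) g0 act0.
have bilg x y : bil (act g mu) x (g *m y) = g *m bil mu (invmx g *m x) y.
  by rewrite bil_act (mulKmx ug).
have gbil x y : bil (act g mu) (g *m x) y = g *m bil mu x (invmx g *m y).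
  by rewrite bil_act (mulKmx ug).
move=> x y z.
rewrite [bil _ y z]bil_act [bil _ x y]bil_act [bil _ x z]bil_act !bilg !gbil.
have [L1 L2] := sL (invmx g *m x) (invmx g *m y) (invmx g *m z).
by rewrite -!mulmxDr -L1 -L2.
Qed.

Lemma act_invmx_line_alg (R : realType) n (B K : 'M[R[i]]_n) (o : 'I_n) (mu : algV R n) :
  B \in unitmx ->
  (forall i j, bil mu (B *m e_ i) (B *m e_ j) = K i j *: (B *m e_ o)) ->
  act (invmx B) mu = line_alg o K.
Proof.
move=> uB BK; apply/ffunP => -[i j]; rewrite !ffunE /= invmxK BK.
by rewrite -scalemxAr (mulKmx uB).
Qed.

Local Notation j0 := (@Ordinal 2 0 isT).
Local Notation j1 := (@Ordinal 2 1 isT).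

Lemma sum2 (V : nmodType) (F : 'I_2 -> V) : \sum_i F i = F j0 + F j1.
Proof.
by rewrite !big_ord_recr big_ord0 /= add0r; congr (F _ + F _); exact: val_inj.
Qed.

Lemma ord2_cases (P : 'I_2 -> Prop) : P j0 -> P j1 -> forall i, P i.
Proof.
by move=> P0 P1 [[|[|//]] lt_i]; [have := P0|have := P1]; congr P; apply: val_inj.
Qed.

(** * The two planar normal forms and their eigenvalues *)

Section Forms2.
Variable C : numClosedFieldType.
Implicit Types K N F G : 'M[C]_2.

Definition square_form : 'M[C]_2 := delta_mx j0 j0.
Definition affine_form : 'M[C]_2 := delta_mx j0 j1 - delta_mx j1 j0.

Lemma square_formE : ((square_form j0 j0 = 1) * (square_form j0 j1 = 0) *
  (square_form j1 j0 = 0) * (square_form j1 j1 = 0))%type.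
Proof. by do !split; rewrite mxE. Qed.

Lemma affine_formE : ((affine_form j0 j0 = 0) * (affine_form j0 j1 = 1) *
  (affine_form j1 j0 = - 1) * (affine_form j1 j1 = 0))%type.
Proof. by do !split; rewrite !mxE /= ?subr0 ?sub0r. Qed.

(** The entries from [line_alg_moment] with o = 1, imposed on an arbitrary matrix so that the
    eigenvalue check is pure arithmetic. *)
Definition is_line_moment K N := forall i j,
  N i j = 2 * (((i == j1) && (j == j1))%:R * \tr (K *m K^t*)
    - (K *m K^t*) j i - (K^t* *m K) i j).

Let mulE F G i j : (F *m G) i j = F i j0 * G j0 j + F i j1 * G j1 j.
Proof. by rewrite mxE sum2. Qed.

Let trE F : \tr F = F j0 j0 + F j1 j1.
Proof. exact: sum2. Qed.

Let ctE F i j : (F^t*) i j = (F j i)^*.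
Proof. by rewrite !mxE. Qed.

Let weightE N K i j : (N j1 j1 *: K - N^T *m K - K *m N) i j =
  N j1 j1 * K i j - (N j0 i * K j0 j + N j1 i * K j1 j) - (K i j0 * N j0 j + K i j1 * N j1 j).
Proof. by rewrite !(mxE, sum2). Qed.

(** N01 = 0 makes e1 an eigenvector of N; the eigenvalue 10 is N11 - 2 N00 with N00 = -4 and N11 =
    2. *)
Lemma square_form_eigen N : is_line_moment square_form N ->
  N j0 j1 = 0 /\ N j1 j1 *: square_form - N^T *m square_form - square_form *m N
                 = 10 *: square_form.
Proof.
move=> NE.
have N00 : N j0 j0 = - 4.
  by rewrite NE !(trE, mulE, ctE, square_formE) !rmorph0 rmorph1 /=; ring.
have N01 : N j0 j1 = 0.
  by rewrite NE !(trE, mulE, ctE, square_formE) !rmorph0 ?rmorph1 /=; ring.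
have N11 : N j1 j1 = 2.
  by rewrite NE !(trE, mulE, ctE, square_formE) !rmorph0 rmorph1 /=; ring.
split=> //; apply/matrixP => i j; rewrite weightE [RHS]mxE N11.
by elim/ord2_cases: i; elim/ord2_cases: j; rewrite !square_formE ?N00 ?N01 ?N11; ring.
Qed.

(** Here N is diagonal, and the eigenvalue 4 is N11 - N00 - N11 = - N00. *)
Lemma affine_form_eigen N : is_line_moment affine_form N ->
  N j0 j1 = 0 /\ N j1 j1 *: affine_form - N^T *m affine_form - affine_form *m N
                 = 4 *: affine_form.
Proof.
move=> NE.
have N00 : N j0 j0 = - 4.
  by rewrite NE !(trE, mulE, ctE, affine_formE) !(rmorph0, rmorphN, rmorph1) /=; ring.
have N01 : N j0 j1 = 0.
  by rewrite NE !(trE, mulE, ctE, affine_formE) !(rmorph0, rmorphN, rmorph1) /=; ring.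
have N10 : N j1 j0 = 0.
  by rewrite NE !(trE, mulE, ctE, affine_formE) !(rmorph0, rmorphN, rmorph1) /=; ring.
have N11 : N j1 j1 = 0.
  by rewrite NE !(trE, mulE, ctE, affine_formE) !(rmorph0, rmorphN, rmorph1) /=; ring.
split=> //; apply/matrixP => i j; rewrite weightE [RHS]mxE N11.
by elim/ord2_cases: i; elim/ord2_cases: j; rewrite !affine_formE ?N00 ?N01 ?N10 ?N11; ring.
Qed.

End Forms2.

(** * Classification in dimension 2 and criticality *)

Section Dim2.
Variable R : realType.
Local Notation C := R[i].

Lemma in_S2_line_alg (mu : algV R 2) : in_S mu ->
  exists2 B : 'M[C]_2, B \in unitmx &
    act (invmx B) mu = line_alg j1 (square_form C) \/
    act (invmx B) mu = line_alg j1 (affine_form C).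
Proof.
move=> [mu0 sL].
have frame_unit (u y : 'cV[C]_2) :
    (forall a b : C, a *: u + b *: y = 0 -> a = 0) -> y != 0 ->
    frame [tuple u; y] \in unitmx.
  move=> ind y0; apply: unitmx_cV_inj => v.
  rewrite (cV_sum_delta v) mulmx_sumr !sum2 -!scalemxAr !frame_delta.
  rewrite !(tnth_nth 0) /= => uy0.
  have a0 := ind _ _ uy0; move: uy0; rewrite a0 !scale0r !add0r => /eqP.
  by rewrite scaler_eq0 (negbTE y0) orbF => /eqP ->; rewrite scale0r.
have [[u uu0]|nsq] := pselect (exists u, bil mu u u != 0).
  set y := bil mu u u in uu0.
  (* Comparing u(uz) = (uu)z + u(uz), and then (zu)u = (zu)u + z(uu), shows that the square y
     annihilates on both sides. *)
  have yl z : bil mu y z = 0.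
    have [E _] := sL u u z; apply: (addIr (bil mu u (bil mu u z))).
    by rewrite add0r -E.
  have yr z : bil mu z y = 0.
    have [_ E] := sL z u u; apply: (addrI (bil mu (bil mu z u) u)).
    by rewrite addr0 -E.
  have uB : frame [tuple u; y] \in unitmx.
    (* Multiplying a u + b y = 0 by u on the left gives a y = 0. *)
    apply: frame_unit => // a b /(congr1 (bil mu u)).
    rewrite bilDr !bilZr yr scaler0 addr0 linear0r => /eqP.
    by rewrite scaler_eq0 (negbTE uu0) orbF => /eqP.
  exists (frame [tuple u; y]) => //; left; apply: act_invmx_line_alg => // i j.
  rewrite !frame_delta; elim/ord2_cases: i; elim/ord2_cases: j;
    by rewrite !(tnth_nth 0) /= ?yl ?yr square_formE ?scale0r ?scale1r.
have sq0 u : bil mu u u = 0.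
  by apply/eqP; apply: contrapT => /negP uu; apply: nsq; exists u.
have anti u v : bil mu u v = - bil mu v u.
  have := sq0 (u + v); rewrite bilDl !bilDr !sq0 add0r addr0 => /eqP.
  by rewrite addr_eq0 => /eqP.
set z := bil mu (e_ j0) (e_ j1).
have z0 : z != 0.
  apply: contra mu0 => /eqP z0; apply/eqP/ffunP => -[i j]; rewrite -bil_delta [RHS]ffunE.
  elim/ord2_cases: i; elim/ord2_cases: j; rewrite ?sq0 //.
  by rewrite anti -/z z0 oppr0.
have zE : z = z j0 0 *: e_ j0 + z j1 0 *: e_ j1.
  by rewrite [LHS]cV_sum_delta sum2.
(* The product is now alternating, so e0 z = z1 z and e1 z = - z0 z in the coordinates of z;
   rescaling e0 or e1 gives a u acting as 1 on z. *)
have [u uz] : exists u, bil mu u z = z.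
  have [z1|z1] := eqVneq (z j1 0) 0.
    have z00 : z j0 0 != 0.
      by apply: contra z0 => /eqP zz; rewrite zE zz z1 !scale0r addr0.
    exists (- (z j0 0)^-1 *: e_ j1).
    rewrite [X in bil _ _ X]zE z1 scale0r addr0 bilZl bilZr anti -/z !scalerN scalerA.
    by rewrite -scaleNr mulNr mulVf // opprK scale1r.
  exists ((z j1 0)^-1 *: e_ j0).
  by rewrite [X in bil _ _ X]zE bilZl bilDr !bilZr sq0 scaler0 add0r -/z scalerA mulVf // scale1r.
have uB : frame [tuple u; z] \in unitmx.
  apply: frame_unit => // a b /(congr1 (bil mu ^~ z)) /=.
  rewrite bilDl !bilZl uz sq0 scaler0 addr0 linear0l => /eqP.
  by rewrite scaler_eq0 (negbTE z0) orbF => /eqP.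
exists (frame [tuple u; z]) => //; right; apply: act_invmx_line_alg => // i j.
rewrite !frame_delta; elim/ord2_cases: i; elim/ord2_cases: j;
  rewrite !(tnth_nth 0) /= affine_formE ?sq0 ?scale0r ?uz ?scale1r //.
by rewrite anti uz scaleN1r.
Qed.

Lemma symmetric_Leibniz2_critical (h : {dot 'cV[C]_2 for Num.conj})
    (X : 2.-tuple 'cV[C]_2) : orthonormal h X ->
  forall mu : algV R 2, in_S mu ->
    exists2 g : 'M[C]_2, g \in unitmx & critical_S h X (act g mu).
Proof.
move=> oX mu muS; have [B uB BE] := in_S2_line_alg muS.
have uX := frame_unitary oX; have iX := unitary_frame_unit uX.
have uB' : invmx B \in unitmx by rewrite unitmx_inv.
have ug : frame X *m invmx B \in unitmx by rewrite unitmx_mul iX.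
(* This carries the basis adapted to [mu] onto the orthonormal basis [X]. *)
exists (frame X *m invmx B) => //.
have gS := in_S_act ug muS; split=> //.
have gE : act (invmx (frame X)) (act (frame X *m invmx B) mu) = act (invmx B) mu.
  by rewrite -(actM _ iX uB') (actK _ iX).
have crit K (c : nat) : act (invmx B) mu = line_alg j1 K ->
    (forall N, is_line_moment K N ->
      N j0 j1 = 0 /\ N j1 j1 *: K - N^T *m K - K *m N = c%:R *: K) ->
    critical_PV h X (act (frame X *m invmx B) mu).
  move=> BK HK; apply: (critical_PV_eigen oX (c := c%:R) uX gS.1).
  rewrite gE BK; set N := moment_form _ _.
  have [N01 NK] := HK N (fun i j => line_alg_moment j1 K i j).
  have No : N *m (e_ j1 : 'cV_2) = N j1 j1 *: e_ j1.
    rewrite -colE; apply/colP; apply: ord2_cases; rewrite [LHS]mxE [RHS]mxE.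
      by rewrite [delta_mx _ _ _ _]mxE N01 mulr0.
    by rewrite [delta_mx _ _ _ _]mxE mulr1.
  rewrite (line_alg_inf_act _ No) NK rmorph_nat.
  by apply/ffunP => p; rewrite !ffunE mxE scalerA.
by case: BE => BE; apply: (crit _ _ BE); [exact: square_form_eigen | exact: affine_form_eigen].
Qed.

End Dim2.

Theorem mainTheorem8 (R : realType) :
  (forall (h : {dot 'cV[R[i]]_2 for Num.conj}) (X : 2.-tuple 'cV[R[i]]_2),
     orthonormal h X ->
     forall mu : algV R 2, in_S mu ->
       exists2 g : 'M[R[i]]_2, g \in unitmx & critical_S h X (act g mu)) /\
  (forall (h : {dot 'cV[R[i]]_3 for Num.conj}) (X : 3.-tuple 'cV[R[i]]_3),
     orthonormal h X ->
     exists2 mu : algV R 3, in_S mu &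
       forall g : 'M[R[i]]_3, g \in unitmx -> ~ critical_S h X (act g mu)).
Proof.
split=> [h X oX mu muS|h X oX].
  exact: symmetric_Leibniz2_critical oX mu muS.
exact: exists_symmetric_Leibniz_not_critical oX.
Qed.
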